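(* Let $P_1,\dots,P_k:[q]\times[q]\to\{0,1\}$ be predicates and suppose there is a set of permutations $S\subseteq S_q$ such that (i) for every $a\in[q]$, if $\pi$ is chosen uniformly from $S$ then $\pi(a)$ is uniform in $[q]$, and (ii) for every $\pi\in S$, every $i$, and all $a,b$ with $P_i(a,b)=1$, also $P_i(\pi(a),\pi(b))=1$. Let $c=\min_i \mathbb E_{a,b\sim[q]}P_i(a,b)$ (with $a,b$ independent uniform). Then for every $\alpha>0$ there is $\varepsilon=\varepsilon(\alpha,q)>0$ such that the degree-$n^\alpha$ Sherali–Adams relaxation provides a $(c+\varepsilon)$-approximation to Max-$P$, the special case of 2CSP with alphabet $[q]$ in which every constraint predicate $\Pi_{ij}$ is one of $P_1,\dots,P_k$.
   Context: An $n$-variable 2CSP instance with alphabet $[q]$ is a pair $(G,\Pi)$: $G$ an $n$-vertex graph with nonnegative edge weights $w_{ij}$ summing to $1$ (simple, undirected, no isolated vertices) and predicates $\Pi_{ij}:[q]\times[q]\to\{0,1\}$ on edges; the value of $x\in[q]^n$ is $\sum w_{ij}\Pi_{ij}(x_i,x_j)$. A $q$-ary $t$-local pseudodistribution is a collection $\{\mu_S\}_{|S|=t}$ of distributions on $[q]^S$ whose marginals on any common subset of size at most $t$ agree; the degree-$t$ Sherali–Adams value $\mathrm{SA}_t(G,\Pi)$ is the maximum over these of $\sum w_{ij}\Pr_{\mu_{ij}}[\Pi_{ij}(X_i,X_j)=1]$. Providing a $\rho$-approximation means that for every instance the optimum value is at least $\rho\cdot\mathrm{SA}_{n^\alpha}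(G,\Pi)$.
   Formalization: The formal theorem adds the assumption c < 1: when c = 1 all predicates are identically 1, so the optimum and the Sherali–Adams value both equal 1 and no (1+ε)-approximation with ε > 0 is possible. *)

(* Defs.v *)
From HB Require Import structures.
From mathcomp Require Import all_boot all_order all_algebra all_fingroup.
From mathcomp Require Import all_classical reals exp.
Set Implicit Arguments.
Unset Strict Implicit.
Unset Printing Implicit Defensive.
Import Order.TTheory GRing.Theory Num.Theory.
Local Open Scope ring_scope.

(* An undirected edge {i, j} is stored in both orientations, so
   [constr i j a b] and [constr j i b a] are the same constraint
   "x_i = a and x_j = b is allowed".  [weight] and [constr] are irrelevant
   off the edges. *)
Record csp (R : realType) (n q : nat) := Csp {
  edge : rel 'I_n;
  weight : 'I_n -> 'I_n -> R;
  constr : 'I_n -> 'I_n -> 'I_q -> 'I_q -> bool;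
  edge_sym : symmetric edge;
  edge_irr : irreflexive edge;
  edge_no_isolated : forall i, exists j, edge i j;
  weight_sym : forall i j, edge i j -> weight i j = weight j i;
  weight_ge0 : forall i j, edge i j -> 0 <= weight i j;
  weight_sum1 :
    \sum_(i < n) \sum_(j < n | (i < j)%N && edge i j) weight i j = 1;
  constr_sym : forall i j a b, edge i j -> constr i j a b = constr j i b a
}.

Definition csp_value (R : realType) (n q : nat) (I : csp R n q)
    (x : {ffun 'I_n -> 'I_q}) : R :=
  \sum_(i < n) \sum_(j < n | (i < j)%N && edge I i j)
    weight I i j * (constr I i j (x i) (x j))%:R.

(* Values are nonnegative, so 0 is a harmless default for the maximum. *)
Definition csp_opt (R : realType) (n q : nat) (I : csp R n q) : R :=
  \big[Num.max/0]_(x : {ffun 'I_n -> 'I_q}) csp_value I x.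

(* [q]^S *)
Notation local_asg q S := {ffun {i | i \in S} -> 'I_q}.

Definition is_dist (R : realType) (T : finType) (m : T -> R) : Prop :=
  (forall x, 0 <= m x) /\ \sum_x m x = 1.

Definition agree (n q : nat) (S T : {set 'I_n})
    (x : local_asg q S) (y : local_asg q T) : bool :=
  [forall u, forall v, (val u == val v) ==> (x u == y v)].

(* Meaningful when T is a subset of S: then x agrees with y iff x|_T = y. *)
Definition marginal (R : realType) (n q : nat) (S T : {set 'I_n})
    (m : local_asg q S -> R) (y : local_asg q T) : R :=
  \sum_(x : local_asg q S | agree x y) m x.

(* Only the components mu S with #|S| = t matter. *)
Definition is_pseudodist (R : realType) (n q t : nat)
    (mu : forall S : {set 'I_n}, local_asg q S -> R) : Prop :=
  (forall S : {set 'I_n}, #|S| = t -> is_dist (mu S)) /\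
  (forall S S' T : {set 'I_n}, #|S| = t -> #|S'| = t ->
     T \subset S -> T \subset S' ->
     marginal (T := T) (mu S) =1 marginal (T := T) (mu S')).

(* mu_T for #|T| <= t, read off from some S of size t containing T; the choice
   of S is irrelevant by [local_marginalE]. *)
Definition local_marginal (R : realType) (n q t : nat)
    (mu : forall S : {set 'I_n}, local_asg q S -> R)
    (T : {set 'I_n}) (y : local_asg q T) : R :=
  if [pick S : {set 'I_n} | (#|S| == t) && (T \subset S)] is Some U
  then marginal (mu U) y else 0.

Lemma local_marginalE (R : realType) (n q t : nat)
    (mu : forall S : {set 'I_n}, local_asg q S -> R) (S T : {set 'I_n}) :
  is_pseudodist t mu -> #|S| = t -> T \subset S ->
  local_marginal t mu (T := T) =1 marginal (mu S).
Proof.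
move=> [_ cons] cS sTS y; rewrite /local_marginal.
case: pickP => [U /andP[/eqP cU sTU] | /(_ S)]; first exact: cons.
by rewrite cS eqxx sTS.
Qed.

(* Pr_{mu_ij}[Q(X_i, X_j) = 1] *)
Definition pair_prob (R : realType) (n q t : nat)
    (mu : forall S : {set 'I_n}, local_asg q S -> R)
    (i j : 'I_n) (Q : 'I_q -> 'I_q -> bool) : R :=
  \sum_(y : local_asg q [set i; j] |
          Q (y (exist _ i (set21 i j))) (y (exist _ j (set22 i j))))
    local_marginal t mu y.

Definition sa_objective (R : realType) (n q t : nat) (I : csp R n q)
    (mu : forall S : {set 'I_n}, local_asg q S -> R) : R :=
  \sum_(i < n) \sum_(j < n | (i < j)%N && edge I i j)
    weight I i j * pair_prob t mu i j (constr I i j).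

Definition sa_value (R : realType) (n q t : nat) (I : csp R n q) : R :=
  sup [set v : R | exists2 mu : forall S : {set 'I_n}, local_asg q S -> R,
                     is_pseudodist t mu & v = sa_objective t I mu]%classic.

(* "Degree n^alpha": rounded down, and clamped to the range 2 <= t <= n in
   which t-local pseudodistributions exist and have pair marginals. *)
Definition sa_degree (R : realType) (alpha : R) (n : nat) : nat :=
  minn n (maxn 2 (Num.truncn (n%:R `^ alpha))).

Definition sa_approximates (R : realType) (q : nat) (alpha rho : R)
    (C : forall n, csp R n q -> Prop) : Prop :=
  forall (n : nat) (I : csp R n q), C n I ->
    rho * sa_value (sa_degree alpha n) I <= csp_opt I.

(* The constraint on an edge is some P l in one of the two orientations. *)
Definition max_P (R : realType) (q k : nat) (P : 'I_k -> 'I_q -> 'I_q -> bool)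
    (n : nat) (I : csp R n q) : Prop :=
  forall i j, edge I i j ->
    exists l, constr I i j =2 P l \/ constr I j i =2 P l.

Definition pred_mean (R : realType) (q : nat) (Q : 'I_q -> 'I_q -> bool) : R :=
  (\sum_(a < q) \sum_(b < q) (Q a b)%:R) / (q ^ 2)%:R.

(* Means are at most 1, so for 0 < k the default 1 does not affect the min. *)
Definition min_mean (R : realType) (q k : nat)
    (P : 'I_k -> 'I_q -> 'I_q -> bool) : R :=
  \big[Num.min/1]_(l < k) pred_mean R (P l).

(* For pi uniform in S and every a, pi(a) is uniform in [q]. *)
Definition uniform_images (R : realType) (q : nat) (S : {set 'S_q}) : Prop :=
  (exists s, s \in S) /\
  forall a b : 'I_q,
    #|[set s in S | s a == b]|%:R / #|S|%:R = q%:R^-1 :> R.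

Definition preserves (q k : nat) (S : {set 'S_q})
    (P : 'I_k -> 'I_q -> 'I_q -> bool) : Prop :=
  forall s : 'S_q, s \in S -> forall l a b, P l a b -> P l (s a) (s b).

(* Main.v *)
Require Import Defs.
From HB Require Import structures.
From mathcomp Require Import all_boot all_order all_algebra all_fingroup.
From mathcomp Require Import boolp reals exp.
From mathcomp Require Import ring lra.
Set Implicit Arguments.
Unset Strict Implicit.
Unset Printing Implicit Defensive.
Import Order.TTheory GRing.Theory Num.Theory.
Local Open Scope ring_scope.

(** The vertex set is split into pieces, each piece is rounded on its own, and
    the pieces are decoupled by independent uniform permutations from [S]:
    these keep the constraints inside a piece satisfied and give an edge
    between two pieces the value of a uniform random assignment, at least [c].
    It therefore suffices that the pieces hold a constant fraction of the edge
    weight and that inside them almost the Sherali-Adams value is recovered.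

    The pieces come from a partition maximizing the sum of a slightly sublinear
    function of the inner weights.  By maximality every subset of a piece of relative volume at most
    [1 / s], where [s] is a small power of [n], sends almost all of its edges
    out of the subset.

    In a piece, conditioning the pseudodistribution on at most [s ^ 4] vertices
    makes the average squared covariance [K] of two random vertices at most
    [s ^ -4], and the conditioned variables are then rounded independently; the
    loss is the correlation along edges.  Let [a_l] be the average of [K] over
    the two ends of an [l]-step random walk.  Local positivity of the
    pseudodistribution gives [a_(2 l) >= a_l ^ 2 - 1 / s], so a large [a_1]
    keeps [a_l] above [2 / s] for [l] of order [log s].  But expansion of small
    sets makes the walk spread (a local Cheeger inequality), so that after so
    many steps its transition density has small L2 norm, and Cauchy-Schwarz
    bounds [a_l] by the global average of [K]. *)

(** * Product distributions and rounding *)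

Lemma sum_indic (R : nzRingType) (T : finType) (t : T) (F : T -> R) :
  \sum_a (t == a)%:R * F a = F t.
Proof.
rewrite (bigD1 t) //= eqxx mul1r big1 ?addr0 // => a /negPf.
by rewrite eq_sym => ->; rewrite mul0r.
Qed.

Lemma cauchy_schwarz (R : realFieldType) (T : finType) (w f g : T -> R) :
  (forall x, 0 <= w x) ->
  (\sum_x w x * (f x * g x)) ^+ 2 <=
  (\sum_x w x * f x ^+ 2) * (\sum_x w x * g x ^+ 2).
Proof.
move=> w0; rewrite expr2 !big_distrlr /=.
rewrite -(ler_pM2l (ltr0Sn R 1)) -subr_ge0.
set A := \sum_i _; set B := \sum_i _.
have -> : 2%:R * A - 2%:R * B =
  \sum_x \sum_y w x * w y * (f x * g y - f y * g x) ^+ 2.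
  have A2 : 2%:R * A = A + \sum_x \sum_y w y * f y ^+ 2 * (w x * g x ^+ 2).
    by rewrite mulr_natl mulr2n {2}/A exchange_big.
  rewrite A2 /A /B mulr_sumr -big_split -sumrB; apply: eq_bigr => x _ /=.
  rewrite mulr_sumr -big_split -sumrB; apply: eq_bigr => y _ /=.
  by ring.
apply: sumr_ge0 => x _; apply: sumr_ge0 => y _.
by rewrite mulr_ge0 ?sqr_ge0 // mulr_ge0.
Qed.

Lemma avg_attained (R : realFieldType) (T : finType) (w F : T -> R) :
  (forall x, 0 <= w x) -> \sum_x w x = 1 ->
  exists2 x, 0 < w x & \sum_y w y * F y <= F x.
Proof.
move=> w0 w1; set e := \sum_y _.
have [[x /andP[wx ex]]|none] :=
    altP (existsP (P := fun x => (0 < w x) && (e <= F x))).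
  by exists x.
have lt x : 0 < w x -> F x < e.
  move=> wx; rewrite ltNge; apply/negP => le.
  by case/existsP: none; exists x; rewrite wx.
have : \sum_y w y * (e - F y) = 0.
  under eq_bigr do rewrite mulrBr.
  by rewrite sumrB -mulr_suml w1 mul1r subrr.
move/eqP; rewrite psumr_eq0 => [/allP z|y _]; last first.
  have := w0 y; rewrite le_eqVlt => /orP[/eqP<-|wy]; first by rewrite mul0r.
  by rewrite mulr_ge0 ?subr_ge0 // ltW // lt.
have : \sum_x w x = 0.
  apply: big1 => x _; have := z x (mem_index_enum _).
  rewrite /= mulf_eq0 => /orP[/eqP//|]; rewrite subr_eq0 => /eqP eF.
  apply/eqP; rewrite -[_ == _]negbK; apply/negP => nz.
  by have := lt x; rewrite lt0r nz w0 -eF ltxx => /(_ isT).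
by rewrite w1 => /eqP; rewrite oner_eq0.
Qed.

Section ProductDistribution.
Variables (R : realFieldType) (I T : finType) (p : I -> T -> R).
Hypothesis p1 : forall i, \sum_a p i a = 1.

Definition prodw (y : {ffun I -> T}) : R := \prod_i p i (y i).

Lemma prodw_sum1 : \sum_y prodw y = 1.
Proof. by rewrite -bigA_distr_bigA big1. Qed.

Lemma prodw_ge0 y : (forall i a, 0 <= p i a) -> 0 <= prodw y.
Proof. by move=> p0; apply: prodr_ge0. Qed.

Lemma prodw_marginal1 i (g : T -> R) :
  \sum_y prodw y * g (y i) = \sum_a p i a * g a.
Proof.
pose p' k c := p k c * (if k == i then g c else 1).
have E y : prodw y * g (y i) = \prod_k p' k (y k).
  rewrite big_split /=; congr (_ * _).
  by rewrite (bigD1 i) //= eqxx big1 ?mulr1 // => k /negPf->.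
under eq_bigr do rewrite E.
rewrite -bigA_distr_bigA (bigD1 i) //= [X in _ * X]big1 => [|k /negPf nk].
  by rewrite mulr1; apply: eq_bigr => a _; rewrite /p' eqxx.
by rewrite -(p1 k); apply: eq_bigr => a _; rewrite /p' nk mulr1.
Qed.

Lemma prodw_marginal2 i j (g : T -> T -> R) : i != j ->
  \sum_y prodw y * g (y i) (y j) = \sum_a \sum_b p i a * p j b * g a b.
Proof.
move=> nij.
pose p' a k c := p k c * (if k == i then (c == a)%:R
                          else if k == j then g a c else 1).
have E y : prodw y * g (y i) (y j) = \sum_a \prod_k p' a k (y k).
  rewrite -(sum_indic (y i) (fun a => g a (y j))) mulr_sumr.
  apply: eq_bigr => a _; rewrite big_split /=; congr (_ * _).
  rewrite (bigD1 i) //= eqxx (bigD1 j) 1?eq_sym //= eqxx [j == i]eq_sym.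
  rewrite (negPf nij) big1 ?mulr1 // => k /andP[/negPf-> /negPf->] //.
under eq_bigr do rewrite E.
rewrite exchange_big /=; apply: eq_bigr => a _.
rewrite -bigA_distr_bigA (bigD1 i) //= (bigD1 j) 1?eq_sym //=.
rewrite [X in _ * (_ * X)]big1 => [|k /andP[/negPf nki /negPf nkj]]; last first.
  by rewrite -(p1 k); apply: eq_bigr => c _; rewrite /p' nki nkj mulr1.
rewrite mulr1 /p' eqxx.
under eq_bigr do rewrite mulrC eq_sym.
rewrite (sum_indic a (p i)) mulr_sumr; apply: eq_bigr => b _.
by rewrite [j == i]eq_sym (negPf nij) eqxx mulrA.
Qed.

End ProductDistribution.

Section Rounding.
Variables (R : realType) (n q : nat).
Variables (W : 'I_n -> 'I_n -> R) (C : 'I_n -> 'I_n -> 'I_q -> 'I_q -> bool).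
Hypothesis W0 : forall i j, 0 <= W i j.
Hypothesis Wii : forall i, W i i = 0.

Definition value (x : {ffun 'I_n -> 'I_q}) : R :=
  \sum_i \sum_j W i j * (C i j (x i) (x j))%:R.

Definition indep_prob (p : 'I_n -> 'I_q -> R) i j : R :=
  \sum_a \sum_b p i a * p j b * (C i j a b)%:R.

Lemma indep_rounding (V : 'I_n -> 'I_n -> bool) (p : 'I_n -> 'I_q -> R) :
  (forall i, is_dist (p i)) ->
  exists y : {ffun 'I_n -> 'I_q},
    \sum_i \sum_j W i j * (V i j)%:R * indep_prob p i j <=
    \sum_i \sum_j W i j * (V i j)%:R * (C i j (y i) (y j))%:R.
Proof.
move=> dp; have p1 i := (dp i).2.
have [||y _ le] := @avg_attained R _ (prodw p)
  (fun y => \sum_i \sum_j W i j * (V i j)%:R * (C i j (y i) (y j))%:R).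
- by move=> y; apply: prodw_ge0 => i a; apply: (dp i).1.
- exact: prodw_sum1.
exists y; apply: le_trans le.
under [leRHS]eq_bigr do rewrite mulr_sumr.
rewrite [leRHS]exchange_big /=; apply: ler_sum => i _.
under [leRHS]eq_bigr do rewrite mulr_sumr.
rewrite [leRHS]exchange_big /=; apply: ler_sum => j _.
have [<-|nij] := eqVneq i j.
  by rewrite Wii !mul0r big1 // => z _; rewrite !mul0r mulr0.
under eq_bigr do rewrite mulrCA.
rewrite -mulr_sumr.
by rewrite (prodw_marginal2 p1 (fun a b => (C i j a b)%:R) nij).
Qed.

Variables (S : {set 'S_q}) (c : R) (L : finType) (f : 'I_n -> L).
Hypothesis Su : uniform_images R S.
Hypothesis SC : forall i j s a b, s \in S -> 0 < W i j ->
  C i j a b -> C i j (s a) (s b).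
Hypothesis cC : forall i j, 0 < W i j -> c <= pred_mean R (C i j).

Let u (s : 'S_q) : R := (s \in S)%:R / #|S|%:R.

Let uE a b : \sum_s u s * (s a == b)%:R = q%:R^-1.
Proof.
rewrite -(Su.2 a b) -sum1_card natr_sum mulr_suml.
rewrite [RHS]big_mkcond /=; apply: eq_bigr => s _.
by rewrite inE /u; case: (s \in S); case: (s a == b); rewrite /= ?mul0r ?mulr0 ?mulr1.
Qed.

Let u_dist : is_dist u.
Proof.
have S_gt0 : (0 < #|S|%:R :> R).
  by case: Su => -[s sS] _; rewrite ltr0n; apply/card_gt0P; exists s.
split=> [s|]; first by rewrite /u divr_ge0 ?ler0n.
rewrite -mulr_suml -natr_sum -[X in X%:R / _]/(\sum_s (s \in S)%N)%N.
have -> : (\sum_s (s \in S) = #|S|)%N.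
  by rewrite -sum1_card [RHS]big_mkcond; apply: eq_bigr => s _; case: (s \in S).
by rewrite divff // gt_eqF.
Qed.

Let u_image (g : 'I_q -> R) a : \sum_s u s * g (s a) = q%:R^-1 * \sum_b g b.
Proof.
under eq_bigr do rewrite -(sum_indic (_ a) g) mulr_sumr.
rewrite exchange_big /= mulr_sumr; apply: eq_bigr => b _.
by rewrite -(uE a b) mulr_suml; apply: eq_bigr => s _; rewrite mulrA.
Qed.

Let u_pair (Q : 'I_q -> 'I_q -> bool) a b :
  \sum_s \sum_s' u s * u s' * (Q (s a) (s' b))%:R = pred_mean R Q.
Proof.
transitivity (\sum_s u s * (q%:R^-1 * \sum_b' (Q (s a) b')%:R)).
  apply: eq_bigr => s _; rewrite -(u_image (fun b' => (Q (s a) b')%:R) b).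
  by rewrite mulr_sumr; apply: eq_bigr => s' _; rewrite mulrA.
rewrite (u_image (fun a' => q%:R^-1 * \sum_b' (Q a' b')%:R)) -mulr_sumr.
by rewrite /pred_mean natrX expr2 invfM mulrA mulrC.
Qed.

Lemma rounding (p : 'I_n -> 'I_q -> R) :
  (forall i, is_dist (p i)) ->
  exists x : {ffun 'I_n -> 'I_q},
    \sum_i \sum_j W i j * (if f i == f j then indep_prob p i j else c) <=
    value x.
Proof.
move=> dp; have [y ley] := indep_rounding (fun i j => f i == f j) dp.
pose x (s : {ffun L -> 'S_q}) := [ffun i => s (f i) (y i)].
pose U := prodw (fun _ : L => u).
have [||s s_gt0 les] := @avg_attained R _ U (fun s => value (x s)).
- by move=> s; apply: prodw_ge0 => _; apply: u_dist.1.
- by apply: prodw_sum1 => _; apply: u_dist.2.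
exists (x s); apply: le_trans les.
pose v i j := if f i == f j then (C i j (y i) (y j))%:R else c.
apply: (@le_trans _ _ (\sum_i \sum_j W i j * v i j)).
  rewrite -subr_ge0; rewrite -subr_ge0 in ley; apply: le_trans ley _.
  rewrite le_eqVlt; apply/orP; left; apply/eqP; rewrite -!sumrB; apply: eq_bigr => i _; rewrite -!sumrB.
  by apply: eq_bigr => j _; rewrite /v; case: eqP => _ /=; ring.
under [leRHS]eq_bigr do rewrite mulr_sumr.
rewrite [leRHS]exchange_big /=; apply: ler_sum => i _.
under [leRHS]eq_bigr do rewrite mulr_sumr.
rewrite [leRHS]exchange_big /=; apply: ler_sum => j _.
under eq_bigr do rewrite mulrCA !ffunE.
rewrite -mulr_sumr.
have := W0 i j; rewrite le_eqVlt => /orP[/eqP<-|Wij]; first by rewrite !mul0r.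
rewrite ler_pM2l // /v; case: eqP => [fij|/eqP fij].
  have <- : \sum_s U s * (C i j (y i) (y j))%:R = (C i j (y i) (y j))%:R.
    by rewrite -mulr_suml prodw_sum1 ?mul1r // => _; apply: u_dist.2.
  apply: ler_sum => z _; have [zS|] := boolP (z (f i) \in S).
    rewrite ler_wpM2l ?ler_nat //.
      by apply: prodw_ge0 => _; apply: u_dist.1.
    rewrite -fij; case: (boolP (C i j (y i) (y j))) => //= /(SC zS Wij) -> //.
  move=> zS; rewrite /U /prodw (bigD1 (f i)) //= /u (negPf zS).
  by rewrite !mul0r.
rewrite (prodw_marginal2 _ (fun s s' : 'S_q => (C i j (s (y i)) (s' (y j)))%:R) fij).
  by rewrite u_pair cC.
by move=> _; apply: u_dist.2.
Qed.
End Rounding.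

(** * Conditional expectations *)

Section Conditioning.
Variables (R : realFieldType) (n q : nat).
Local Notation Omega := {ffun 'I_n -> 'I_q}.
Implicit Types (T S : {set 'I_n}) (mu : Omega -> R) (f g h : Omega -> R).

Definition agr T (x z : Omega) : bool := [forall u in T, x u == z u].

Definition ex mu f : R := \sum_x mu x * f x.

Definition local T f : Prop := forall x z, agr T x z -> f x = f z.

Definition cexp mu T f (z : Omega) : R :=
  (\sum_x mu x * (agr T x z)%:R * f x) / (\sum_x mu x * (agr T x z)%:R).

Definition cov mu T f g (z : Omega) : R :=
  cexp mu T (fun x => f x * g x) z - cexp mu T f z * cexp mu T g z.

Lemma agr_refl T x : agr T x x.
Proof. by apply/forall_inP. Qed.

Lemma agr_sym T x z : agr T x z = agr T z x.
Proof. by apply: eq_forallb => u; rewrite eq_sym. Qed.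

Lemma agr_trans T x y z : agr T x y -> agr T y z -> agr T x z.
Proof.
move=> /forall_inP xy /forall_inP yz; apply/forall_inP => u uT.
by rewrite (eqP (xy u uT)) yz.
Qed.

Lemma agr_subset T T' x z : T \subset T' -> agr T' x z -> agr T x z.
Proof.
by move=> sT /forall_inP xz; apply/forall_inP => u /(subsetP sT); apply: xz.
Qed.

Lemma agr_eql T x y z : agr T x y -> agr T x z = agr T y z.
Proof.
move=> xy; apply/idP/idP; last exact: agr_trans.
by apply: agr_trans; rewrite agr_sym.
Qed.

Lemma local_subset T T' f : T \subset T' -> local T f -> local T' f.
Proof. by move=> sT lf x z xz; apply: lf; apply: agr_subset xz. Qed.

Lemma local_agr T z : local T (fun x => (agr T x z)%:R).
Proof. by move=> x y xy; rewrite (agr_eql z xy). Qed.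

Lemma localM T f g : local T f -> local T g -> local T (fun x => f x * g x).
Proof. by move=> lf lg x z xz; rewrite (lf _ _ xz) (lg _ _ xz). Qed.

Lemma local_cexp mu T f : local T (cexp mu T f).
Proof.
move=> x z xz; rewrite /cexp; congr (_ / _); apply: eq_bigr => y _;
by rewrite ![agr T y _]agr_sym (agr_eql y xz).
Qed.

Lemma local_cov mu T f g : local T (cov mu T f g).
Proof. by move=> x z xz; rewrite /cov !(local_cexp _ _ xz). Qed.

Lemma ex_sum mu (I : finType) (F : I -> Omega -> R) :
  ex mu (fun x => \sum_i F i x) = \sum_i ex mu (F i).
Proof. by rewrite exchange_big /=; apply: eq_bigr => x _; rewrite mulr_sumr. Qed.

Lemma exD mu f g : ex mu (fun x => f x + g x) = ex mu f + ex mu g.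
Proof. by rewrite -big_split; apply: eq_bigr => x _; rewrite mulrDr. Qed.

Lemma exZ mu a f : ex mu (fun x => a * f x) = a * ex mu f.
Proof. by rewrite mulr_sumr; apply: eq_bigr => x _; rewrite mulrCA. Qed.

Lemma ex_eq mu f g : f =1 g -> ex mu f = ex mu g.
Proof. by move=> fg; apply: eq_bigr => x _; rewrite fg. Qed.

Section Dist.
Variable mu : Omega -> R.
Hypothesis mu0 : forall x, 0 <= mu x.

Lemma ler_ex f g : (forall x, f x <= g x) -> ex mu f <= ex mu g.
Proof. by move=> fg; apply: ler_sum => x _; rewrite ler_wpM2l. Qed.

Lemma ex_ge0 f : (forall x, 0 <= f x) -> 0 <= ex mu f.
Proof. by move=> f0; apply: sumr_ge0 => x _; rewrite mulr_ge0. Qed.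

Let prob T z := \sum_x mu x * (agr T x z)%:R.

Lemma prob_ge T z : mu z <= prob T z.
Proof.
rewrite /prob (bigD1 z) //= agr_refl mulr1 lerDl.
by apply: sumr_ge0 => x _; rewrite mulr_ge0.
Qed.

Lemma tower T f h : local T h ->
  ex mu (fun z => cexp mu T f z * h z) = ex mu (fun z => f z * h z).
Proof.
move=> lh; rewrite /ex /cexp.
transitivity (\sum_z \sum_x
    mu x * f x * h x * (mu z * (agr T z x)%:R / prob T x)).
  apply: eq_bigr => z _; rewrite -/(prob T z) !mulr_suml mulr_sumr.
  apply: eq_bigr => x _.
  rewrite [agr T z x]agr_sym; case: (boolP (agr T x z)) => [xz|_].
    have -> : prob T x = prob T z.
      apply: eq_bigr => y _; congr (_ * _%:R).
      by rewrite ![agr T y _]agr_sym (agr_eql y xz).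
    by rewrite (lh _ _ xz) /prob; ring.
  by rewrite !(mulr0, mul0r).
rewrite exchange_big /=; apply: eq_bigr => x _.
rewrite -mulr_sumr -mulr_suml -/(prob T x) mulrA.
have := mu0 x; rewrite le_eqVlt => /orP[/eqP<-|mx]; first by rewrite !mul0r.
rewrite mulfK ?mulrA // gt_eqF //.
exact: lt_le_trans mx (prob_ge T x).
Qed.

Lemma cexp_pull T f h z : local T h ->
  cexp mu T (fun x => f x * h x) z = cexp mu T f z * h z.
Proof.
move=> lh; rewrite /cexp mulrAC; congr (_ / _); rewrite mulr_suml.
apply: eq_bigr => x _; case: (boolP (agr T x z)) => [xz|_].
  by rewrite (lh _ _ xz) !mulrA.
by rewrite !(mulr0, mul0r).
Qed.

Lemma cexp_sum T (I : finType) (F : I -> Omega -> R) z :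
  cexp mu T (fun x => \sum_i F i x) z = \sum_i cexp mu T (F i) z.
Proof.
rewrite /cexp -mulr_suml exchange_big /=; congr (_ / _).
by apply: eq_bigr => x _; rewrite mulr_sumr.
Qed.

Lemma cexpB T f g z :
  cexp mu T (fun x => f x - g x) z = cexp mu T f z - cexp mu T g z.
Proof.
rewrite /cexp -mulrBl -sumrB; congr (_ / _).
by apply: eq_bigr => x _; rewrite mulrBr.
Qed.

Lemma ler_cexp T f g z : (forall x, f x <= g x) ->
  cexp mu T f z <= cexp mu T g z.
Proof.
move=> fg; rewrite /cexp ler_wpM2r //.
  by rewrite invr_ge0 sumr_ge0 // => x _; rewrite mulr_ge0.
by apply: ler_sum => x _; rewrite ler_wpM2l // mulr_ge0.
Qed.

Lemma cexp_ge0 T f z : (forall x, 0 <= f x) -> 0 <= cexp mu T f z.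
Proof.
move=> f0; rewrite /cexp divr_ge0 // sumr_ge0 // => x _;
by rewrite ?mulr_ge0.
Qed.

Lemma cexp_cst_le T a z : 0 <= a -> cexp mu T (fun=> a) z <= a.
Proof.
move=> a0; rewrite /cexp -mulr_suml mulrAC.
have [->|nz] := eqVneq (\sum_x mu x * (agr T x z)%:R) 0; first by rewrite !mul0r.
by rewrite divff // mul1r.
Qed.

Lemma cexp_cst T a z : 0 < mu z -> cexp mu T (fun=> a) z = a.
Proof.
move=> mz; rewrite /cexp -mulr_suml mulrAC divff ?mul1r //.
by rewrite gt_eqF // (lt_le_trans mz) ?prob_ge.
Qed.

Lemma cexp_refine T T' f h z : T \subset T' -> local T' h ->
  cexp mu T (fun x => h x * cexp mu T' f x) z =
  cexp mu T (fun x => h x * f x) z.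
Proof.
move=> sT lh; rewrite [LHS]/cexp [RHS]/cexp; congr (_ / _).
have lh' : local T' (fun x => (agr T x z)%:R * h x).
  by apply: localM => //; apply: local_subset sT _; apply: local_agr.
have := tower f lh'; rewrite /ex => e.
transitivity (\sum_x mu x * (cexp mu T' f x * ((agr T x z)%:R * h x))).
  by apply: eq_bigr => x _; ring.
by rewrite e; apply: eq_bigr => x _; ring.
Qed.

Lemma cexp_schwarz T f g z :
  cexp mu T (fun x => f x * g x) z ^+ 2 <=
  cexp mu T (fun x => f x ^+ 2) z * cexp mu T (fun x => g x ^+ 2) z.
Proof.
rewrite /cexp expr_div_n mulrACA -expr2 -exprVn ler_wpM2r ?sqr_ge0 //.
by apply: cauchy_schwarz => x; rewrite mulr_ge0.
Qed.

End Dist.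
End Conditioning.

(** * Correlations of a pseudodistribution *)

Section PseudoDistribution.
Variables (R : realType) (n q : nat).
Local Notation Omega := {ffun 'I_n -> 'I_q}.
Implicit Types (T S V : {set 'I_n}) (mu : Omega -> R) (f g h : Omega -> R).

Definition ind (u : 'I_n) (a : 'I_q) (x : Omega) : R := (x u == a)%:R.

Lemma ind_ge0 u a x : 0 <= ind u a x.
Proof. exact: ler0n. Qed.

Lemma ind_le1 u a x : ind u a x <= 1.
Proof. by rewrite /ind lern1 leq_b1. Qed.

Lemma local_ind u a T : u \in T -> local T (ind u a).
Proof. by move=> uT x z /forall_inP/(_ u uT)/eqP; rewrite /ind => ->. Qed.

Definition corr mu T u v (z : Omega) : R :=
  \sum_a \sum_b cov mu T (ind u a) (ind v b) z ^+ 2.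

Section OneDist.
Variable mu : Omega -> R.
Hypothesis mu0 : forall x, 0 <= mu x.
Hypothesis mu1 : \sum_x mu x = 1.

Lemma cexp_le1 T f z : (forall x, f x <= 1) -> cexp mu T f z <= 1.
Proof.
move=> f1; apply: le_trans (cexp_cst_le mu T z ler01).
exact: ler_cexp.
Qed.

Lemma corr_ge0 T u v z : 0 <= corr mu T u v z.
Proof. by apply: sumr_ge0 => a _; apply: sumr_ge0 => b _; apply: sqr_ge0. Qed.

Lemma corr_le T u v z : corr mu T u v z <= (q ^ 2)%:R.
Proof.
have -> : (q ^ 2)%:R = \sum_(a < q) \sum_(b < q) 1 :> R.
  by rewrite !sumr_const !card_ord -mulrnA.
apply: ler_sum => a _; apply: ler_sum => b _.
rewrite -real_normK ?num_real // expr_le1 //.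
rewrite /cov.
have i01 w c : 0 <= cexp mu T (ind w c) z <= 1.
  apply/andP; split; [apply: cexp_ge0 => // x|apply: cexp_le1 => x].
  exact: ind_le1.
have p01 : 0 <= cexp mu T (fun x => ind u a x * ind v b x) z <= 1.
  apply/andP; split; [apply: cexp_ge0 => // x|apply: cexp_le1 => x].
    by rewrite mulr_ge0 ?ind_ge0.
  by rewrite mulr_ile1 ?ind_ge0 ?ind_le1.
have /andP[a0 a1] := i01 u a; have /andP[b0 b1] := i01 v b.
have /andP[p0 p1] := p01.
have m0 := mulr_ge0 a0 b0.
have m1 := mulr_ile1 a0 b0 a1 b1.
by rewrite ler_norml; apply/andP; split; lra.
Qed.

Lemma ex_le_const f B : (forall x, f x <= B) -> ex mu f <= B.
Proof.
move=> fB; have -> : B = ex mu (fun=> B) by rewrite /ex -mulr_suml mu1 mul1r.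
exact: ler_ex.
Qed.

Lemma variance_gain T u f :
  \sum_a ex mu (fun z => cov mu T (ind u a) f z ^+ 2) <=
  ex mu (fun z => cexp mu (u |: T) f z ^+ 2) -
  ex mu (fun z => cexp mu T f z ^+ 2).
Proof.
set T' := u |: T; set g' := cexp mu T' f; set g := cexp mu T f.
pose h x := g' x - g x.
have sT : T \subset T' by apply: subsetUr.
have -> : ex mu (fun z => g' z ^+ 2) - ex mu (fun z => g z ^+ 2) =
          ex mu (fun z => h z ^+ 2).
  have e1 : ex mu (fun z => g' z * g z) = ex mu (fun z => g z * g z).
    have lg : local T g by apply: local_cexp.
    rewrite (tower mu0 f (local_subset sT lg)).
    by rewrite [RHS](tower mu0 f lg).
  have -> : ex mu (fun z => h z ^+ 2) = ex mu (fun z => g' z ^+ 2) -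
     2 * ex mu (fun z => g' z * g z) + ex mu (fun z => g z ^+ 2).
    rewrite -exZ -mulN1r -exZ -!exD; apply: ex_eq => z; rewrite /h; ring.
  rewrite e1 (_ : ex mu (fun z => g z * g z) = ex mu (fun z => g z ^+ 2)).
    by ring.
  by apply: ex_eq => z; rewrite expr2.
rewrite -ex_sum.
have -> : ex mu (fun z => h z ^+ 2) =
          ex mu (cexp mu T (fun z => h z ^+ 2)).
  have := @tower _ _ _ mu mu0 T (fun z => h z ^+ 2) (fun=> 1).
  rewrite (@ex_eq _ _ _ _ _ (cexp mu T (fun z => h z ^+ 2))); last first.
    by move=> z; rewrite mulr1.
  by move=> ->; [apply: ex_eq => z; rewrite mulr1|].
apply: ler_ex => // z.
have covE a : cov mu T (ind u a) f z =
              cexp mu T (fun x => ind u a x * (ind u a x * h x)) z.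
  have -> : (fun x => ind u a x * (ind u a x * h x)) =
            (fun x => ind u a x * g' x - ind u a x * g x).
    apply/funext => x; rewrite /h /ind; case: (x u == a) => /=; ring.
  rewrite cexpB cexp_refine //; last by apply: local_ind; apply: setU11.
  by rewrite (cexp_pull _ _ _ (h := g)) //; apply: local_cexp.
apply: (@le_trans _ _ (\sum_a cexp mu T (fun x => (ind u a x * h x) ^+ 2) z)).
  apply: ler_sum => a _; rewrite covE.
  apply: le_trans (cexp_schwarz mu0 _ _ _ _) _.
  rewrite -[leRHS]mul1r ler_wpM2r ?cexp_ge0 // => [x|]; first exact: sqr_ge0.
  by apply: cexp_le1 => x; rewrite expr_le1 ?ind_ge0 ?ind_le1.
rewrite -cexp_sum le_eqVlt; apply/orP; left; apply/eqP; congr cexp.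
apply/funext => x; under eq_bigr do rewrite exprMn.
rewrite -mulr_suml -[RHS]mul1r; congr (_ * _).
rewrite (bigD1 (x u)) //= {1}/ind eqxx expr1n big1 ?addr0 // => a /negPf.
by rewrite eq_sym /ind => ->; rewrite expr0n.
Qed.

Lemma corr_psd (J : finType) (U : J -> 'I_n) (y : J -> R) T z :
  0 < mu z ->
  0 <= \sum_i \sum_j y i * y j * corr mu T (U i) (U j) z.
Proof.
move=> mz.
pose p := \sum_x mu x * (agr T x z)%:R.
pose w x := mu x * (agr T x z)%:R / p.
have p0 : 0 < p by apply: lt_le_trans mz (prob_ge mu0 T z).
have w0 x : 0 <= w x by rewrite /w divr_ge0 ?mulr_ge0 // ltW.
have w1 : \sum_x w x = 1 by rewrite -mulr_suml divff // gt_eqF.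
have ceE f : cexp mu T f z = \sum_x w x * f x.
  by rewrite /cexp mulr_suml; apply: eq_bigr => x _; rewrite /w mulrAC.
pose Y i a x := ind (U i) a x - cexp mu T (ind (U i) a) z.
have covE i j a b :
    cov mu T (ind (U i) a) (ind (U j) b) z = \sum_x w x * (Y i a x * Y j b x).
  rewrite /cov /Y; set A := cexp mu T (ind (U i) a) z.
  set B := cexp mu T (ind (U j) b) z.
  have eA : \sum_x w x * ind (U i) a x = A by rewrite -ceE.
  have eB : \sum_x w x * ind (U j) b x = B by rewrite -ceE.
  rewrite ceE; transitivity (\sum_x w x * (ind (U i) a x * ind (U j) b x)
    - B * (\sum_x w x * ind (U i) a x) - A * (\sum_x w x * ind (U j) b x)
    + A * B * \sum_x w x); first by rewrite eA eB w1; ring.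
  rewrite !mulr_sumr -!sumrB -big_split /=; apply: eq_bigr => x _.
  by rewrite -/A -/B; ring.
pose Z x x' := \sum_i y i * \sum_a Y i a x * Y i a x'.
suff -> : \sum_i \sum_j y i * y j * corr mu T (U i) (U j) z =
  \sum_x \sum_x' w x * w x' * Z x x' ^+ 2.
  apply: sumr_ge0 => x _; apply: sumr_ge0 => x' _.
  by rewrite mulr_ge0 ?sqr_ge0 // mulr_ge0.
transitivity (\sum_i \sum_j \sum_x \sum_x' w x * w x' *
   ((y i * \sum_a Y i a x * Y i a x') * (y j * \sum_b Y j b x * Y j b x'))).
  apply: eq_bigr => i _; apply: eq_bigr => j _.
  rewrite /corr mulr_sumr; under eq_bigr do rewrite mulr_sumr.
  transitivity (\sum_a \sum_b \sum_x \sum_x' y i * y j * (w x * w x') *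
    ((Y i a x * Y i a x') * (Y j b x * Y j b x'))).
    apply: eq_bigr => a _; apply: eq_bigr => b _.
    rewrite covE expr2 big_distrlr /= mulr_sumr; apply: eq_bigr => x _.
    by rewrite mulr_sumr; apply: eq_bigr => x' _; ring.
  under eq_bigr => a _ do rewrite exchange_big /=.
  rewrite exchange_big /=; apply: eq_bigr => x _.
  under eq_bigr => a _ do rewrite exchange_big /=.
  rewrite exchange_big /=; apply: eq_bigr => x' _.
  transitivity (y i * y j * (w x * w x') *
    ((\sum_a Y i a x * Y i a x') * (\sum_b Y j b x * Y j b x'))); last by ring.
  rewrite big_distrlr /= mulr_sumr; apply: eq_bigr => a _.
  by rewrite mulr_sumr.
under eq_bigr => i _ do rewrite exchange_big /=.
rewrite exchange_big /=; apply: eq_bigr => x _.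
under eq_bigr => i _ do rewrite exchange_big /=.
rewrite exchange_big /=; apply: eq_bigr => x' _.
rewrite expr2 /Z big_distrlr /= [RHS]mulr_sumr; apply: eq_bigr => i _.
by rewrite [RHS]mulr_sumr.
Qed.

End OneDist.

Definition pseudodist (t : nat) (D : {set 'I_n} -> Omega -> R) : Prop :=
  (forall S, (#|S| <= t)%N -> is_dist (D S)) /\
  (forall S S' T f, (#|S| <= t)%N -> (#|S'| <= t)%N ->
     T \subset S -> T \subset S' -> local T f -> ex (D S) f = ex (D S') f).

Variables (t : nat) (D : {set 'I_n} -> Omega -> R).
Hypothesis pdD : pseudodist t D.

Definition gcorr T u v : R :=
  ex (D (u |: (v |: T))) (corr (D (u |: (v |: T))) T u v).

Lemma cexp_pd S S' T V f z : (#|S| <= t)%N -> (#|S'| <= t)%N ->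
  T :|: V \subset S -> T :|: V \subset S' -> local V f ->
  cexp (D S) T f z = cexp (D S') T f z.
Proof.
move=> cS cS' sS sS' lf.
have [TV VT] := (subsetUl T V, subsetUr T V).
have e h : local (T :|: V) h -> ex (D S) h = ex (D S') h.
  by apply: pdD.2.
have la : local (T :|: V) (fun x => (agr T x z)%:R : R).
  by apply: local_subset TV _; apply: local_agr.
rewrite /cexp; congr (_ / _); last exact: e.
have lg := localM la (local_subset VT lf).
by have := e _ lg; rewrite /ex; under eq_bigr do rewrite mulrA;
  under [in RHS]eq_bigr do rewrite mulrA.
Qed.

Lemma cov_pd S S' T u v a b z : (#|S| <= t)%N -> (#|S'| <= t)%N ->
  u |: (v |: T) \subset S -> u |: (v |: T) \subset S' ->
  cov (D S) T (ind u a) (ind v b) z = cov (D S') T (ind u a) (ind v b) z.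
Proof.
move=> cS cS' sS sS'; rewrite /cov.
have E V f : V \subset [set u; v] -> local V f ->
    cexp (D S) T f z = cexp (D S') T f z.
  move=> sV; apply: cexp_pd => //; [apply: subset_trans sS|apply: subset_trans sS'];
  by rewrite setUA setUC setSU.
rewrite (E [set u; v]) //; last first.
  by apply: localM; apply: local_ind; rewrite !inE eqxx ?orbT.
rewrite (E [set u]) ?sub1set ?set21 //; last by apply: local_ind; rewrite set11.
by rewrite (E [set v]) ?sub1set ?set22 //; apply: local_ind; rewrite set11.
Qed.

Lemma corr_pd S S' T u v z : (#|S| <= t)%N -> (#|S'| <= t)%N ->
  u |: (v |: T) \subset S -> u |: (v |: T) \subset S' ->
  corr (D S) T u v z = corr (D S') T u v z.
Proof.
move=> cS cS' sS sS'; apply: eq_bigr => a _; apply: eq_bigr => b _.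
by rewrite (cov_pd a b z cS cS' sS sS').
Qed.

Lemma local_corr mu T u v : local T (corr mu T u v).
Proof.
move=> x z xz; apply: eq_bigr => a _; apply: eq_bigr => b _.
by congr (_ ^+ 2); apply: local_cov.
Qed.

Lemma gcorrE S S' T u v : (#|S| <= t)%N -> (#|S'| <= t)%N ->
  u |: (v |: T) \subset S -> T \subset S' ->
  gcorr T u v = ex (D S') (corr (D S) T u v).
Proof.
move=> cS cS' sS sS'; rewrite /gcorr; set S0 := u |: (v |: T).
have cS0 : (#|S0| <= t)%N by apply: leq_trans (subset_leq_card sS) cS.
rewrite (ex_eq _ (fun z => corr_pd z cS0 cS (subxx _) sS)).
apply: (pdD.2 _ _ T) => //; last exact: local_corr.
by rewrite /S0 setUA subsetUr.
Qed.

Lemma cardsU1_leq u T : (#|u |: T| <= #|T|.+1)%N.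
Proof. by rewrite cardsU1 -add1n leq_add2r leq_b1. Qed.

Lemma cardsU2_leq u v T : (#|u |: (v |: T)| <= #|T|.+2)%N.
Proof. by apply: leq_trans (cardsU1_leq _ _) _; rewrite ltnS cardsU1_leq. Qed.

Lemma gcorr_sym T u v : gcorr T u v = gcorr T v u.
Proof.
rewrite /gcorr setUCA; apply: ex_eq => z.
rewrite /corr exchange_big; apply: eq_bigr => a _; apply: eq_bigr => b _.
rewrite /cov mulrC; congr ((cexp _ _ _ _ - _) ^+ 2).
by apply/funext => x; rewrite mulrC.
Qed.

Lemma gcorr_ge0 T u v : (#|T| + 2 <= t)%N -> 0 <= gcorr T u v.
Proof.
move=> cT; apply: ex_ge0 => [x|z]; last exact: corr_ge0.
apply: (pdD.1 _ _).1; apply: leq_trans (cardsU2_leq _ _ _) _.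
by rewrite -addn2.
Qed.

Lemma gcorr_le T u v : (#|T| + 2 <= t)%N -> gcorr T u v <= (q ^ 2)%:R.
Proof.
move=> cT; have cS : (#|u |: (v |: T)| <= t)%N.
  by apply: leq_trans (cardsU2_leq _ _ _) _; rewrite -addn2.
have [m0 m1] := pdD.1 _ cS.
by apply: ex_le_const => // z; apply: corr_le.
Qed.

Definition pot T v : R :=
  ex (D (v |: T)) (fun z => \sum_a cexp (D (v |: T)) T (ind v a) z ^+ 2).

Lemma potE S T v : (#|S| <= t)%N -> v |: T \subset S ->
  pot T v = ex (D S) (fun z => \sum_a cexp (D S) T (ind v a) z ^+ 2).
Proof.
move=> cS sS; have cvT := leq_trans (subset_leq_card sS) cS.
rewrite /pot (pdD.2 _ S T) ?subsetUr //; last 2 first.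
- by apply: subset_trans sS; apply: subsetUr.
- move=> x z xz; apply: eq_bigr => a _; congr (_ ^+ 2).
  exact: local_cexp.
apply: ex_eq => z; apply: eq_bigr => a _; congr (_ ^+ 2).
apply: (@cexp_pd _ _ _ [set v]) => //; rewrite 1?setUC //.
by apply: local_ind; rewrite set11.
Qed.

Lemma pot_ge0 T v : (#|T| < t)%N -> 0 <= pot T v.
Proof.
move=> cT; have [m0 m1] := pdD.1 _ (leq_trans (cardsU1_leq v T) cT).
by apply: ex_ge0 => // z; apply: sumr_ge0 => a _; apply: sqr_ge0.
Qed.

Lemma pot_le1 T v : (#|T| < t)%N -> pot T v <= 1.
Proof.
move=> cT; have [m0 m1] := pdD.1 _ (leq_trans (cardsU1_leq v T) cT).
apply: ex_le_const => // z.
apply: (@le_trans _ _ (\sum_a cexp (D (v |: T)) T (ind v a) z)).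
  apply: ler_sum => a _; have c0 : 0 <= cexp (D (v |: T)) T (ind v a) z.
    by apply: cexp_ge0 => // x; apply: ind_ge0.
  rewrite expr2 ler_piMl //; apply: cexp_le1 => // x; exact: ind_le1.
rewrite -cexp_sum; apply: cexp_le1 => // x.
have := sum_indic (x v) (fun=> 1 : R); under eq_bigr do rewrite mulr1.
by rewrite /ind => ->.
Qed.

Lemma pot_gain T u v : (#|T| + 2 <= t)%N ->
  gcorr T u v <= pot (u |: T) v - pot T v.
Proof.
move=> cT; set S := u |: (v |: T).
have cS : (#|S| <= t)%N.
  by apply: leq_trans (cardsU2_leq _ _ _) _; rewrite -addn2.
have [m0 m1] := pdD.1 _ cS.
rewrite (@potE S) ?(@potE S T) ?subsetUr //; last by rewrite /S setUCA.
rewrite /gcorr -/S /corr !ex_sum -sumrB.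
under eq_bigr do rewrite ex_sum.
rewrite exchange_big /=; apply: ler_sum => b _.
exact: variance_gain.
Qed.

Lemma conditioning (p : 'I_n -> R) (r : nat) :
  (0 < r)%N -> (r + 2 <= t)%N -> is_dist p ->
  exists2 T : {set 'I_n}, (#|T| <= r)%N &
    forall u, \sum_v p v * gcorr T u v <= r%:R^-1.
Proof.
move=> r0 rt [p0 p1].
have rR : 0 < r%:R :> R by rewrite ltr0n.
pose Psi T := \sum_v p v * pot T v.
have Psi0 T : (#|T| < t)%N -> 0 <= Psi T.
  by move=> cT; apply: sumr_ge0 => v _; rewrite mulr_ge0 ?pot_ge0.
have Psi1 T : (#|T| < t)%N -> Psi T <= 1.
  move=> cT; rewrite -p1; apply: ler_sum => v _.
  by rewrite ler_piMr // pot_le1.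
pose F T : R := Psi T - #|T|%:R / r%:R.
have [T cT maxT] := @arg_maxP _ _ _ set0 (fun T => #|T| <= r.+1)%N F
  (leq_trans (eq_leq (cards0 _)) (leq0n _)).
have Tr : (#|T| <= r)%N.
  have := maxT set0; rewrite cards0 => /(_ isT); rewrite /F cards0 mul0r subr0.
  move=> le0; rewrite addn2 in rt.
  have := Psi0 set0; rewrite cards0 => /(_ (leq_trans (ltn0Sn _) rt)) h0.
  have h1 := Psi1 T (leq_ltn_trans cT rt).
  rewrite -(ler_nat R) -[leRHS]mul1r -ler_pdivrMr //.
  by move: le0; set x := _ / _ => /= le0; lra.
exists T => // u.
have := maxT (u |: T) (leq_trans (cardsU1_leq _ _) _); rewrite ltnS => /(_ Tr).
rewrite /F /= => le.
have gain : \sum_v p v * gcorr T u v <= Psi (u |: T) - Psi T.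
  rewrite -sumrB; apply: ler_sum => v _; rewrite -mulrBr ler_wpM2l //.
  by apply: pot_gain; apply: leq_trans rt; rewrite leq_add2r.
apply: (le_trans gain).
have : #|u |: T|%:R / r%:R <= (#|T|%:R + 1) / r%:R :> R.
  by rewrite ler_pM2r ?invr_gt0 // natr1 ler_nat cardsU1_leq.
rewrite mulrDl mul1r; move: le; set x := _ / _; set y := _ / _.
move=> h1 h2; lra.
Qed.

Lemma gcorr_psd (J : finType) (U : J -> 'I_n) (y : J -> R) T :
  (#|T| + #|J| <= t)%N ->
  0 <= \sum_i \sum_j y i * y j * gcorr T (U i) (U j).
Proof.
move=> cT; pose S := T :|: [set U i | i : J].
have cS : (#|S| <= t)%N.
  apply: leq_trans cT; rewrite cardsU; apply: leq_trans (leq_subr _ _) _.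
  by rewrite leq_add2l leq_imset_card.
have [m0 m1] := pdD.1 _ cS.
have E i j : gcorr T (U i) (U j) = ex (D S) (corr (D S) T (U i) (U j)).
  apply: gcorrE; rewrite ?subsetUl //; apply/subsetP => x.
  rewrite !inE => /orP[/eqP->|/orP[/eqP->|->//]];
  by rewrite imset_f ?orbT.
have -> : \sum_i \sum_j y i * y j * gcorr T (U i) (U j) =
    ex (D S) (fun z => \sum_i \sum_j y i * y j * corr (D S) T (U i) (U j) z).
  rewrite ex_sum; apply: eq_bigr => i _; rewrite ex_sum; apply: eq_bigr => j _.
  by rewrite exZ E.
apply: sumr_ge0 => z _; have := m0 z.
rewrite le_eqVlt => /orP[/eqP<-|mz]; first by rewrite mul0r.
by rewrite mulr_ge0 // corr_psd.
Qed.

Lemma gcorr_walk T (r : nat) (rho : 'I_n -> R) (v : 'I_n) (c : R) :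
  (0 < r)%N -> (#|T| + r.+1 <= t)%N -> is_dist rho ->
  0 <= c ^+ 2 * gcorr T v v - 2 * c * (\sum_w rho w * gcorr T v w)
     + (\sum_w \sum_w' rho w * rho w' * gcorr T w w') + (q ^ 2)%:R / r%:R.
Proof.
move=> r0 cT [rho0 rho1].
have rR : 0 < r%:R :> R by rewrite ltr0n.
have c2 : (#|T| + 2 <= t)%N by apply: leq_trans cT; rewrite leq_add2l.
pose K := gcorr T; pose B : R := (q ^ 2)%:R.
pose a := \sum_w rho w * K v w.
pose b := \sum_w \sum_w' rho w * rho w' * K w w'.
have b0 : 0 <= b.
  apply: sumr_ge0 => w _; apply: sumr_ge0 => w' _.
  by rewrite !mulr_ge0 // gcorr_ge0.
pose mu : {ffun 'I_r -> 'I_n} -> R := prodw (fun _ => rho).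
have mu0 w : 0 <= mu w by apply: prodw_ge0 => _.
have mu1 : \sum_w mu w = 1 by apply: prodw_sum1.
pose s1 (w : {ffun 'I_r -> 'I_n}) := \sum_i K v (w i).
pose s2 (w : {ffun 'I_r -> 'I_n}) := \sum_i \sum_j K (w i) (w j).
have pos w : 0 <= c ^+ 2 * K v v - 2 * c / r%:R * s1 w + s2 w / r%:R ^+ 2.
  pose U (i : 'I_r.+1) := if unlift ord0 i is Some j then w j else v.
  pose y (i : 'I_r.+1) : R := if i == ord0 then c else - r%:R^-1.
  have := @gcorr_psd _ U y T; rewrite card_ord => /(_ cT).
  have U0 : U ord0 = v by rewrite /U unlift_none.
  have Ul i : U (lift ord0 i) = w i by rewrite /U liftK.
  suff -> : \sum_i \sum_j y i * y j * gcorr T (U i) (U j) =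
    c ^+ 2 * K v v - 2 * c / r%:R * s1 w + s2 w / r%:R ^+ 2 by [].
  have y0 : y ord0 = c by [].
  have yl i : y (lift ord0 i) = - r%:R^-1 by [].
  rewrite -/K !big_ord_recl U0 y0.
  under eq_bigr do rewrite Ul yl.
  under [X in _ + X = _]eq_bigr => i _ do
    (rewrite big_ord_recl U0 y0 Ul yl; under eq_bigr do rewrite Ul yl).
  rewrite -mulr_sumr big_split /= -mulr_sumr.
  under [X in _ + (_ * X + _)]eq_bigr do rewrite /K gcorr_sym -/K.
  rewrite -/(s1 w).
  have -> : \sum_(i < r) \sum_(j < r) - r%:R^-1 * - r%:R^-1 * K (w i) (w j) =
     s2 w / r%:R ^+ 2.
    rewrite mulr_suml; apply: eq_bigr => i _; rewrite mulr_suml.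
    by apply: eq_bigr => j _; rewrite expr2 invfM; ring.
  by rewrite expr2; ring.
have avg : 0 <= \sum_w mu w * (c ^+ 2 * K v v - 2 * c / r%:R * s1 w + s2 w / r%:R ^+ 2).
  by apply: sumr_ge0 => w _; rewrite mulr_ge0.
have e1 : \sum_w mu w * s1 w = r%:R * a.
  under eq_bigr do rewrite mulr_sumr.
  rewrite exchange_big /= -[r in r%:R]card_ord -sum1_card natr_sum mulr_suml.
  apply: eq_bigr => i _; rewrite mul1r.
  exact: (prodw_marginal1 _ i (K v)).
have e2 : \sum_w mu w * s2 w <= r%:R * B + r%:R ^+ 2 * b.
  have -> : r%:R * B + r%:R ^+ 2 * b =
      \sum_(i < r) (B + \sum_(j < r) b).
    by rewrite !sumr_const card_ord -[(_ + _) *+ r]mulr_natl -[b *+ r]mulr_natl; ring.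
  under eq_bigr do rewrite mulr_sumr.
  rewrite exchange_big /=; apply: ler_sum => i _.
  under eq_bigr do rewrite mulr_sumr.
  rewrite exchange_big /= (bigD1 i) //= [X in _ <= _ + X](bigD1 i) //= addrA.
  apply: lerD.
    rewrite -[leLHS]addr0 lerD //.
    under eq_bigr do rewrite mulrC.
    apply: (@le_trans _ _ (\sum_w B * mu w)); last by rewrite -mulr_sumr mu1 mulr1.
    by apply: ler_sum => w _; rewrite ler_wpM2r // gcorr_le.
  apply: ler_sum => j; rewrite eq_sym => nij.
  by rewrite (prodw_marginal2 _ K nij).
have : \sum_w mu w * (c ^+ 2 * K v v - 2 * c / r%:R * s1 w + s2 w / r%:R ^+ 2) =
  c ^+ 2 * K v v - 2 * c * a + (\sum_w mu w * s2 w) / r%:R ^+ 2.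
  have -> : 2 * c * a = 2 * c / r%:R * \sum_w mu w * s1 w.
    by rewrite e1; field; rewrite gt_eqF.
  have e0 : c ^+ 2 * K v v = \sum_w mu w * (c ^+ 2 * K v v).
    by rewrite -mulr_suml mu1 mul1r.
  rewrite [in RHS]e0.
  rewrite [2 * c / r%:R * _]mulr_sumr mulr_suml -sumrB -big_split.
  by apply: eq_bigr => w _ /=; ring.
move=> e; rewrite e in avg; apply: le_trans avg _.
rewrite -/K -/a -/b -/B -[leRHS]addrA lerD2l ler_pdivrMr ?exprn_gt0 //.
apply: le_trans e2 _; rewrite le_eqVlt; apply/orP; left; apply/eqP.
by field; rewrite gt_eqF.
Qed.

End PseudoDistribution.

(** * Random walks and small set expansion *)

Section Walk.
Variables (R : realType) (V : finType) (W : V -> V -> R).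
Implicit Types (f g : V -> R).
Hypothesis W0 : forall u v, 0 <= W u v.
Hypothesis Wsym : forall u v, W u v = W v u.

Definition deg u : R := \sum_v W u v.
Definition step f u : R := (\sum_w W u w * f w) / deg u.
Definition dot f g : R := \sum_u deg u * (f u * g u).

Lemma deg_ge0 u : 0 <= deg u.
Proof. exact: sumr_ge0. Qed.

Lemma deg0W u v : deg u = 0 -> W u v = 0.
Proof.
move=> /eqP; rewrite psumr_eq0 // => /allP/(_ v (mem_index_enum _)).
by move/eqP.
Qed.

Lemma deg_step f u : deg u * step f u = \sum_w W u w * f w.
Proof.
have [d0|d0] := eqVneq (deg u) 0.
  by rewrite d0 mul0r big1 // => w _; rewrite deg0W ?mul0r.
by rewrite /step mulrC mulfVK.
Qed.

Lemma step_ge0 f : (forall u, 0 <= f u) -> forall u, 0 <= step f u.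
Proof.
move=> f0 u; rewrite /step divr_ge0 ?deg_ge0 // sumr_ge0 // => w _.
by rewrite mulr_ge0.
Qed.

Lemma dotC f g : dot f g = dot g f.
Proof. by apply: eq_bigr => u _; rewrite [f u * _]mulrC. Qed.

Lemma dotDl f g h : dot (fun u => f u + g u) h = dot f h + dot g h.
Proof. by rewrite -big_split; apply: eq_bigr => u _ /=; ring. Qed.

Lemma dot_ge0 f g : (forall u, 0 <= f u) -> (forall u, 0 <= g u) ->
  0 <= dot f g.
Proof.
by move=> f0 g0; apply: sumr_ge0 => u _; rewrite mulr_ge0 ?deg_ge0 // mulr_ge0.
Qed.

Lemma dot_step f g : dot f (step g) = \sum_u \sum_v W u v * (f u * g v).
Proof.
apply: eq_bigr => u _; rewrite mulrCA deg_step mulr_sumr.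
by apply: eq_bigr => v _; ring.
Qed.

Lemma dot_step_sym f g : dot (step f) g = dot f (step g).
Proof.
rewrite dotC !dot_step exchange_big /=; apply: eq_bigr => u _.
by apply: eq_bigr => v _; rewrite Wsym [f u * _]mulrC.
Qed.

Lemma step_contract f : dot (step f) (step f) <= dot f f.
Proof.
apply: (@le_trans _ _ (\sum_u \sum_v W u v * f v ^+ 2)).
  apply: ler_sum => u _.
  have [d0|d0] := eqVneq (deg u) 0.
    by rewrite d0 mul0r sumr_ge0 // => v _; rewrite mulr_ge0 ?sqr_ge0.
  have dp : 0 < deg u by rewrite lt0r d0 deg_ge0.
  rewrite mulrA deg_step -(ler_pM2l dp) mulrCA deg_step -expr2.
  have := @cauchy_schwarz _ _ (W u) (fun=> 1) f (W0 u).
  under eq_bigr do rewrite mul1r.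
  by under [X in X * _]eq_bigr do rewrite expr1n mulr1.
rewrite exchange_big /= le_eqVlt; apply/orP; left; apply/eqP.
apply: eq_bigr => v _; rewrite -mulr_suml -expr2; congr (_ * _).
by apply: eq_bigr => u _.
Qed.

(* The density of the [l]-step random walk from [v] with respect to [deg]. *)
Definition heat l v : V -> R := iter l step (fun u => (u == v)%:R / deg v).

Lemma heat_ge0 l v u : 0 <= heat l v u.
Proof.
elim: l u => [|l IH] u; last exact: step_ge0.
by rewrite /heat /= divr_ge0 ?deg_ge0.
Qed.

Lemma heat_deg0 l v u : deg u = 0 -> heat l v u = 0.
Proof.
move=> d0; case: l => [|l]; last by rewrite /heat iterS /step d0 invr0 mulr0.
rewrite /heat /=; case: eqP => [<-|_]; last by rewrite mul0r.
by rewrite d0 invr0 mulr0.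
Qed.

Lemma dot_heat a b v w : dot (heat a v) (heat b w) = heat (a + b) w v.
Proof.
elim: a b => [|a IH] b; last first.
  rewrite {1}/heat iterS dot_step_sym -/(heat a v).
  by have -> : step (heat b w) = heat b.+1 w by []; rewrite IH addnS.
rewrite /dot (bigD1 v) //= big1 ?addr0 => [|u /negPf nuv]; last first.
  by rewrite /heat /= nuv !mul0r mulr0.
rewrite {1}/heat /= eqxx div1r.
have [d0|d0] := eqVneq (deg v) 0; first by rewrite d0 mul0r heat_deg0.
by rewrite mulrA divff // mul1r.
Qed.

Lemma heat_sym l v w : heat l v w = heat l w v.
Proof. by rewrite -[l in RHS]add0n -dot_heat dotC dot_heat addn0. Qed.

Lemma heat_mass l v : deg v != 0 -> \sum_u deg u * heat l v u = 1.
Proof.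
move=> d0; elim: l => [|l IH].
  rewrite (bigD1 v) //= big1 ?addr0 => [|u /negPf nuv].
    by rewrite /heat /= eqxx div1r divff.
  by rewrite /heat /= nuv mul0r mulr0.
rewrite -[RHS]IH; under eq_bigr do rewrite /heat iterS deg_step -/(heat l v).
rewrite exchange_big /=; apply: eq_bigr => u _.
by rewrite -mulr_suml; congr (_ * _); apply: eq_bigr => w _.
Qed.

Lemma heat_mass_le1 l v : \sum_u deg u * heat l v u <= 1.
Proof.
have [d0|d0] := eqVneq (deg v) 0; last by rewrite heat_mass.
by rewrite big1 // => u _; rewrite heat_sym heat_deg0 // mulr0.
Qed.

Lemma layer_cake (eta : R) (h : V -> R) :
  (forall u, 0 <= h u) ->
  (forall B : {set V}, (forall u, u \in B -> 0 < h u) ->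
     \sum_(u in B) \sum_(v in B) W u v <= eta * \sum_(u in B) deg u) ->
  \sum_u \sum_v W u v * Num.min (h u) (h v) <= eta * \sum_u deg u * h u.
Proof.
have [N] := ubnP #|[set u | 0 < h u]|; elim: N => // N IH in h *.
rewrite ltnS => cN h0 hB; set B := [set u | 0 < h u].
have hB0 u : u \notin B -> h u = 0.
  by rewrite inE -leNgt => le; apply/eqP; rewrite eq_le le h0.
have [B0|[u0 u0B]] := set_0Vmem B.
  have z u : h u = 0 by apply: hB0; rewrite B0 inE.
  rewrite !big1 ?mulr0 // => u _; first by rewrite z mulr0.
  by rewrite big1 // => v _; rewrite !z minxx mulr0.
have [w wB hw] := @arg_minP _ _ _ u0 (fun u => u \in B) h u0B.
pose h' u := h u - h w * (u \in B)%:R.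
have h'0 u : 0 <= h' u.
  rewrite /h'; case: (boolP (u \in B)) => [uB|/hB0->]; last first.
    by rewrite mulr0 subr0.
  by rewrite mulr1 subr_ge0; apply: hw.
have sup u : 0 < h' u -> u \in B :\ w.
  rewrite /h' in_setD1; have [->|_] := eqVneq u w.
    by rewrite wB mulr1 subrr ltxx.
  by case: (boolP (u \in B)) => // /hB0->; rewrite mulr0 subrr ltxx.
have le : \sum_u \sum_v W u v * Num.min (h' u) (h' v) <=
          eta * \sum_u deg u * h' u.
  apply: IH => // [|C hC].
    apply: leq_trans cN; rewrite -/B (cardsD1 w B) wB add1n ltnS.
    by apply/subset_leq_card/subsetP => u; rewrite inE => /sup.
  by apply: hB => u /hC /sup; rewrite in_setD1 inE => /andP[_].
have eqm u v : Num.min (h u) (h v) =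
    Num.min (h' u) (h' v) + h w * ((u \in B)%:R * (v \in B)%:R).
  rewrite /h'; case: (boolP (u \in B)) => [uB|/hB0 ->].
    case: (boolP (v \in B)) => [vB|/hB0 ->].
      by rewrite !mulr1 addr_minl !subrK.
    rewrite !(mulr0, mulr1) subr0 addr0 !min_r //.
    by rewrite subr_ge0; apply: hw.
  rewrite mul0r !mulr0 subr0 addr0 !min_l //.
  by have := h'0 v; rewrite /h'.
have -> : \sum_u \sum_v W u v * Num.min (h u) (h v) =
  \sum_u \sum_v W u v * Num.min (h' u) (h' v) +
  h w * \sum_(u in B) \sum_(v in B) W u v.
  rewrite [\sum_(u in B) _]big_mkcond mulr_sumr -big_split.
  apply: eq_bigr => u _ /=.
  rewrite (_ : (if _ then _ else _) =
     \sum_v W u v * ((u \in B)%:R * (v \in B)%:R)).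
    rewrite mulr_sumr -big_split; apply: eq_bigr => v _ /=.
    by rewrite eqm; ring.
  case: ifP => _; last by rewrite big1 // => v _; rewrite mul0r mulr0.
  rewrite big_mkcond; apply: eq_bigr => v _ /=.
  by rewrite mul1r; case: ifP => _; rewrite ?mulr1 ?mulr0.
have -> : \sum_u deg u * h u = \sum_u deg u * h' u + h w * \sum_(u in B) deg u.
  rewrite [\sum_(u in B) _]big_mkcond mulr_sumr -big_split.
  apply: eq_bigr => u _ /=; rewrite /h'.
  by case: ifP => _ /=; ring.
rewrite mulrDr lerD // mulrCA ler_wpM2l //.
by apply: hB => u; rewrite inE.
Qed.

(* Level sets above [L / tau] have volume at most [tau] by Markov, so they do
   not hold many edges; below that threshold [min (f u) (f v) ^+ 2] is
   controlled by the l1 norm. *)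
Lemma local_cheeger (lam tau L : R) f :
  0 < lam -> 0 < tau -> 0 < L ->
  (forall B : {set V}, \sum_(u in B) deg u <= tau ->
     \sum_(u in B) \sum_(v in B) W u v <= 2 * lam ^+ 2 * \sum_(u in B) deg u) ->
  (forall u, 0 <= f u) -> \sum_u deg u * f u <= L ->
  dot f (step f) <= 2 * lam * dot f f + L ^+ 2 / (2 * lam * tau).
Proof.
move=> lam0 tau0 L0 sse f0 fL; pose th := L / tau.
have th0 : 0 < th by rewrite divr_gt0.
pose h u := if th < f u then f u ^+ 2 - th ^+ 2 else 0.
have h0 u : 0 <= h u.
  rewrite /h; case: ifP => // lt.
  by rewrite subr_ge0 ler_sqr ?nnegrE ?ltW // (lt_trans th0).
have hf u : h u <= f u ^+ 2.
  rewrite /h; case: ifP => _; last exact: sqr_ge0.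
  by rewrite gerBl sqr_ge0.
have lc : \sum_u \sum_v W u v * Num.min (h u) (h v) <=
          2 * lam ^+ 2 * \sum_u deg u * h u.
  apply: layer_cake => // B hB; apply: sse.
  rewrite -(ler_pM2l th0); apply: (@le_trans _ _ L); last first.
    by rewrite /th divfK ?gt_eqF.
  apply: le_trans fL; rewrite mulr_sumr big_mkcond /=.
  apply: ler_sum => u _; case: ifP => [/hB|_]; last by rewrite mulr_ge0 ?deg_ge0.
  rewrite /h; case: ifP => [lt _|]; last by rewrite ltxx.
  by rewrite mulrC ler_wpM2l ?deg_ge0 // ltW.
have pt u v : f u * f v <=
    (2 * lam)^-1 * (Num.min (h u) (h v) + th * f u) +
    lam / 2 * (f u ^+ 2 + f v ^+ 2).
  have key (m M : R) : 0 <= m -> m <= M ->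
      m * M <= (2 * lam)^-1 * m ^+ 2 + lam / 2 * (m ^+ 2 + M ^+ 2).
    move=> m0 mM.
    have -> : (2 * lam)^-1 * m ^+ 2 + lam / 2 * (m ^+ 2 + M ^+ 2) =
      m * M + (lam / 2 * m ^+ 2 + (2 * lam)^-1 * (m - lam * M) ^+ 2).
      by field; rewrite gt_eqF.
    rewrite lerDl addr_ge0 // mulr_ge0 ?sqr_ge0 ?divr_ge0 ?invr_ge0 ?mulr_ge0 //;
    by rewrite ltW.
  have minb (a b : R) : a = f u \/ a = f v -> 0 <= a -> a <= f u -> a <= f v ->
     a ^+ 2 <= Num.min (h u) (h v) + th * f u.
    move=> eab a0 au av; have thu : 0 <= th * f u by rewrite mulr_ge0 // ltW.
    have [alt|agt] := leP a th.
      apply: (@le_trans _ _ (th * f u)).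
        by rewrite expr2 ler_pM.
      by rewrite lerDr le_min !h0.
    have ha w : a <= f w -> a ^+ 2 - th ^+ 2 <= h w.
      move=> aw; rewrite /h (lt_le_trans agt aw) lerD2r.
      by rewrite ler_sqr ?nnegrE.
    have : a ^+ 2 - th ^+ 2 <= Num.min (h u) (h v) by rewrite le_min !ha.
    have : th ^+ 2 <= th * f u.
      by rewrite expr2 ler_pM2l // ltW // (lt_le_trans agt).
    by move: (Num.min _ _) => mm; lra.
  have c0 : 0 <= (2 * lam)^-1 by rewrite invr_ge0 mulr_ge0 // ltW.
  have [le|/ltW le] := leP (f u) (f v).
    apply: le_trans (key _ _ (f0 u) le) _; rewrite lerD2r ler_wpM2l //.
    by apply: (minb _ 0) => //; left.
  rewrite mulrC [f u ^+ 2 + _]addrC.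
  apply: le_trans (key _ _ (f0 v) le) _; rewrite lerD2r ler_wpM2l //.
  by apply: (minb _ 0) => //; right.
rewrite dot_step.
apply: (@le_trans _ _ (\sum_u \sum_v W u v *
  ((2 * lam)^-1 * (Num.min (h u) (h v) + th * f u) +
    lam / 2 * (f u ^+ 2 + f v ^+ 2)))).
  by apply: ler_sum => u _; apply: ler_sum => v _; rewrite ler_wpM2l.
have -> : \sum_u \sum_v W u v *
  ((2 * lam)^-1 * (Num.min (h u) (h v) + th * f u) +
    lam / 2 * (f u ^+ 2 + f v ^+ 2)) =
  (2 * lam)^-1 * (\sum_u \sum_v W u v * Num.min (h u) (h v)) +
  (2 * lam)^-1 * th * (\sum_u deg u * f u) + lam * dot f f.
  have -> : lam * dot f f = lam / 2 * (\sum_u \sum_v W u v * f u ^+ 2) +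
                            lam / 2 * (\sum_u \sum_v W u v * f v ^+ 2).
    rewrite [X in _ = _ + _ * X]exchange_big /=.
    have e : \sum_u \sum_v W u v * f u ^+ 2 = dot f f.
      by apply: eq_bigr => u _; rewrite -mulr_suml expr2.
    rewrite [X in _ = _ + _ * X](_ : _ = dot f f); first by rewrite e; field.
    rewrite -e; apply: eq_bigr => u _; apply: eq_bigr => v _.
    by rewrite Wsym.
  rewrite !mulr_sumr -!big_split; apply: eq_bigr => u _ /=.
  rewrite [deg u * _]mulr_suml !mulr_sumr -!big_split; apply: eq_bigr => v _ /=.
  by ring.
have F : \sum_u deg u * h u <= dot f f.
  by apply: ler_sum => u _; rewrite -expr2 ler_wpM2l ?deg_ge0.
apply: (@le_trans _ _ ((2 * lam)^-1 * (2 * lam ^+ 2 * dot f f) +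
   (2 * lam)^-1 * th * L + lam * dot f f)).
  rewrite lerD2r lerD // ler_wpM2l //.
  - by rewrite invr_ge0 mulr_ge0 // ltW.
  - apply: le_trans lc _; rewrite ler_wpM2l // mulr_ge0 ?sqr_ge0 //.
  - by apply: mulr_ge0; rewrite ?(ltW th0) // invr_ge0 mulr_ge0 ?(ltW lam0).
rewrite le_eqVlt; apply/orP; left; apply/eqP; rewrite /th.
by field; rewrite !gt_eqF.
Qed.

Section Expansion.
Variables (lam tau : R).
Hypotheses (lam0 : 0 < lam) (tau0 : 0 < tau).
Hypothesis sse : forall B : {set V}, \sum_(u in B) deg u <= tau ->
  \sum_(u in B) \sum_(v in B) W u v <= 2 * lam ^+ 2 * \sum_(u in B) deg u.

(* Apply the Cheeger bound to [f + step f], whose energy is at least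
   [2 * dot (step f) (step f)]. *)
Lemma step_decay f : (forall u, 0 <= f u) -> \sum_u deg u * f u <= 1 ->
  dot (step f) (step f) <= 4 * lam * dot f f + (lam * tau)^-1.
Proof.
move=> f0 f1; pose g u := f u + step f u.
have sf0 := step_ge0 f0.
have mass : \sum_u deg u * step f u = \sum_u deg u * f u.
  under eq_bigr do rewrite deg_step.
  rewrite exchange_big /=; apply: eq_bigr => u _.
  by rewrite -mulr_suml; congr (_ * _); apply: eq_bigr => w _.
have gL : \sum_u deg u * g u <= 2.
  under eq_bigr do rewrite mulrDr.
  by rewrite big_split /= mass; lra.
have := @local_cheeger lam tau 2 g lam0 tau0 (ltr0Sn _ _) sse
  (fun u => addr_ge0 (f0 u) (sf0 u)) gL.
have gg : dot g g <= 4 * dot f f.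
  have : 0 <= dot (fun u => f u - step f u) (fun u => f u - step f u).
    by apply: sumr_ge0 => u _; rewrite mulr_ge0 ?deg_ge0 // -expr2 sqr_ge0.
  have -> : dot (fun u => f u - step f u) (fun u => f u - step f u) =
     2 * dot f f + 2 * dot (step f) (step f) - dot g g.
    rewrite !mulr_sumr -big_split -sumrB; apply: eq_bigr => u _ /=.
    by rewrite /g; ring.
  by have := step_contract f; lra.
have low : 2 * dot (step f) (step f) <= dot g (step g).
  have e k : dot k (step g) = dot k (step f) + dot k (step (step f)).
    rewrite -dot_step_sym dotC [LHS]dotDl ![dot _ (step k)]dotC.
    by rewrite !dot_step_sym.
  rewrite [leRHS]dotDl !e -[dot f (step (step f))]dot_step_sym.
  have := dot_ge0 f0 sf0; have := dot_ge0 sf0 (step_ge0 sf0).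
  by move: (dot _ _) (dot _ _) (dot _ _) => a b c; lra.
set F := dot f f in gg *; set F' := dot (step f) _ in low *.
move=> h; have l4 : 2 * lam * dot g g <= 2 * lam * (4 * F).
  by rewrite ler_wpM2l // mulr_ge0 // ltW.
have -> : (lam * tau)^-1 = (2 ^+ 2 / (2 * lam * tau)) / 2.
  by field; rewrite !gt_eqF.
by lra.
Qed.

Lemma heat_decay l v : 4 * lam <= 1 / 2 ->
  dot (heat l v) (heat l v) <=
  (4 * lam) ^+ l * dot (heat 0 v) (heat 0 v) + 2 / (lam * tau).
Proof.
move=> l12; have e0 : 0 < (lam * tau)^-1 by rewrite invr_gt0 mulr_gt0.
elim: l => [|l IH]; first by rewrite expr0 mul1r lerDl divr_ge0 // ltW // mulr_gt0.
have := step_decay (heat_ge0 l v) (heat_mass_le1 l v).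
rewrite -[step _]/(heat l.+1 v) => h; apply: le_trans h _.
have : 4 * lam * dot (heat l v) (heat l v) <=
  4 * lam * ((4 * lam) ^+ l * dot (heat 0 v) (heat 0 v) + 2 / (lam * tau)).
  by rewrite ler_wpM2l // mulr_ge0 // ltW.
have : 4 * lam * (lam * tau)^-1 <= 1 / 2 * (lam * tau)^-1 by rewrite ler_pM2r.
rewrite exprS; move: (dot _ _) (_ ^+ _) (dot _ _) => a b c.
by move: ((lam * tau)^-1) => d; lra.
Qed.

Lemma heat_trace l : 4 * lam <= 1 / 2 -> \sum_v deg v = 1 ->
  \sum_v deg v * dot (heat l v) (heat l v) <=
  (4 * lam) ^+ l * #|V|%:R + 2 / (lam * tau).
Proof.
move=> l12 d1.
have -> : (4 * lam) ^+ l * #|V|%:R + 2 / (lam * tau) =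
    \sum_v ((4 * lam) ^+ l + deg v * (2 / (lam * tau))).
  by rewrite big_split /= sumr_const -mulr_suml d1 mul1r mulr_natr.
apply: ler_sum => v _.
apply: (le_trans (ler_wpM2l (deg_ge0 v) (heat_decay l v l12))).
rewrite mulrDr lerD2r mulrCA -[leRHS]mulr1 ler_wpM2l //.
  by rewrite exprn_ge0 // mulr_ge0 // ltW.
rewrite dot_heat /heat /= eqxx div1r.
by have [->|d0] := eqVneq (deg v) 0; rewrite ?mul0r // divff.
Qed.

End Expansion.

Section Correlation.
Variable K : V -> V -> R.
Hypothesis K01 : forall u v, 0 <= K u v <= 1.
Hypothesis d1 : \sum_v deg v = 1.

Definition walk_corr l : R :=
  \sum_u \sum_v deg u * deg v * heat l u v * K u v.

Lemma walk_corr1 : walk_corr 1 = \sum_u \sum_v W u v * K u v.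
Proof.
apply: eq_bigr => u _; apply: eq_bigr => v _; congr (_ * _).
rewrite -mulrA /heat iterS deg_step /= (bigD1 u) //= big1 ?addr0 => [|w /negPf nw].
  rewrite eqxx div1r Wsym mulrCA.
  have [d0|d0] := eqVneq (deg u) 0; first by rewrite deg0W ?mul0r.
  by rewrite divff ?mulr1.
by rewrite nw mul0r mulr0.
Qed.

Lemma walk_corr_double (e : R) l :
  (forall v rho c, is_dist rho ->
    0 <= c ^+ 2 * K v v - 2 * c * (\sum_w rho w * K v w)
         + (\sum_w \sum_w' rho w * rho w' * K w w') + e) ->
  walk_corr l ^+ 2 - e <= walk_corr (l + l).
Proof.
move=> psd; set c := walk_corr l.
pose rho v w := deg w * heat l v w.
have pos v : 0 <= deg v * (c ^+ 2 * K v v - 2 * c * (\sum_w rho v w * K v w)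
         + (\sum_w \sum_w' rho v w * rho v w' * K w w') + e).
  have [->|d0] := eqVneq (deg v) 0; first by rewrite mul0r.
  rewrite mulr_ge0 ?deg_ge0 //; apply: psd; split; last exact: heat_mass.
  by move=> w; rewrite mulr_ge0 ?deg_ge0 ?heat_ge0.
have : 0 <= \sum_v deg v * (c ^+ 2 * K v v - 2 * c * (\sum_w rho v w * K v w)
         + (\sum_w \sum_w' rho v w * rho v w' * K w w') + e).
  by apply: sumr_ge0.
have -> : \sum_v deg v * (c ^+ 2 * K v v - 2 * c * (\sum_w rho v w * K v w)
         + (\sum_w \sum_w' rho v w * rho v w' * K w w') + e) =
  c ^+ 2 * (\sum_v deg v * K v v) - 2 * c * c + walk_corr (l + l) + e.
  have -> : walk_corr (l + l) =
    \sum_v deg v * (\sum_w \sum_w' rho v w * rho v w' * K w w').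
    under [RHS]eq_bigr do rewrite mulr_sumr.
    rewrite [RHS]exchange_big /=; apply: eq_bigr => w _.
    under [RHS]eq_bigr do rewrite mulr_sumr.
    rewrite [RHS]exchange_big /=; apply: eq_bigr => w' _.
    rewrite -(dot_heat l l w' w) mulr_sumr mulr_suml; apply: eq_bigr => v _.
    by rewrite /rho (heat_sym l w' v) (heat_sym l w v); ring.
  have e1 : 2 * c * c = \sum_v deg v * (2 * c * (\sum_w rho v w * K v w)).
    rewrite {2}/c /walk_corr mulr_sumr; apply: eq_bigr => v _.
    rewrite !mulr_sumr; apply: eq_bigr => w _.
    by rewrite /rho; ring.
  have e2 : e = \sum_v deg v * e by rewrite -mulr_suml d1 mul1r.
  rewrite e1 [in RHS]e2 mulr_sumr -sumrB -!big_split.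
  by apply: eq_bigr => v _ /=; ring.
have : c ^+ 2 * (\sum_v deg v * K v v) <= c ^+ 2.
  rewrite -[leRHS]mulr1 ler_wpM2l ?sqr_ge0 // -d1; apply: ler_sum => v _.
  by rewrite ler_piMr ?deg_ge0 //; case/andP: (K01 v v).
by rewrite !expr2 => h1 h2; lra.
Qed.

Lemma walk_corr_bound l :
  walk_corr l ^+ 2 <= (\sum_v deg v * dot (heat l v) (heat l v)) *
                      (\sum_u \sum_v deg u * deg v * K u v).
Proof.
have := @cauchy_schwarz R (V * V)%type (fun p => deg p.1 * deg p.2)
   (fun p => heat l p.1 p.2) (fun p => K p.1 p.2)
   (fun p => mulr_ge0 (deg_ge0 _) (deg_ge0 _)).
rewrite -(pair_bigA _ (fun u v => deg u * deg v * (heat l u v * K u v))).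
rewrite -(pair_bigA _ (fun u v => deg u * deg v * heat l u v ^+ 2)).
rewrite -(pair_bigA _ (fun u v => deg u * deg v * K u v ^+ 2)) /=.
have -> : \sum_u \sum_v deg u * deg v * (heat l u v * K u v) = walk_corr l.
  by apply: eq_bigr => u _; apply: eq_bigr => v _; rewrite mulrA.
move=> h; apply: le_trans h _.
have -> : \sum_u \sum_v deg u * deg v * heat l u v ^+ 2 =
          \sum_v deg v * dot (heat l v) (heat l v).
  apply: eq_bigr => u _; rewrite mulr_sumr; apply: eq_bigr => v _.
  by rewrite expr2; ring.
rewrite ler_wpM2l //.
  by apply: sumr_ge0 => v _; rewrite mulr_ge0 ?deg_ge0 // dot_ge0 // => u; apply: heat_ge0.
apply: ler_sum => u _; apply: ler_sum => v _.
rewrite ler_wpM2l ?mulr_ge0 ?deg_ge0 // expr2.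
by have /andP[k0 k1] := K01 u v; rewrite ler_piMr.
Qed.

(* If edges were correlated at more than [2 / h], repeated doubling would keep
   the correlation at distance [2 ^ k] above [2 / s], which the trace bound and
   the small global correlation forbid. *)
Lemma edge_corr_bound (h lam : R) (k : nat) (r : R) :
  let s := h ^+ (2 ^ k) in
  2 <= h -> 0 < lam -> 4 * lam <= 1 / 2 ->
  (forall B : {set V}, \sum_(u in B) deg u <= s^-1 ->
     \sum_(u in B) \sum_(v in B) W u v <= 2 * lam ^+ 2 * \sum_(u in B) deg u) ->
  (forall v rho c, is_dist rho ->
    0 <= c ^+ 2 * K v v - 2 * c * (\sum_w rho w * K v w)
         + (\sum_w \sum_w' rho w * rho w' * K w w') + s^-1) ->
  (forall u, \sum_v deg v * K u v <= r) ->
  ((4 * lam) ^+ (2 ^ k) * #|V|%:R + 2 * s / lam) * r < 4 / s ^+ 2 ->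
  \sum_u \sum_v W u v * K u v <= 2 / h.
Proof.
move=> s h2 lam0 l12 sse psd glob num.
have h0 : 0 < h by apply: lt_le_trans h2.
have h1 : 1 <= h by apply: le_trans h2; rewrite ler1n.
have s0 : 0 < s by rewrite exprn_gt0.
rewrite -walk_corr1 leNgt; apply/negP => big.
have dbl j : (j <= k)%N -> 2 / h ^+ (2 ^ j) <= walk_corr (2 ^ j).
  elim: j => [|j IH] jk; first by rewrite expn0 expr1 ltW.
  have {}IH := IH (ltnW jk); rewrite expnS mul2n -addnn.
  have := walk_corr_double (2 ^ j) psd.
  set x := h ^+ (2 ^ j) in IH *.
  have x0 : 0 < x by rewrite exprn_gt0.
  have sq : (2 / x) ^+ 2 <= walk_corr (2 ^ j) ^+ 2.
    by rewrite ler_sqr ?nnegrE // ?(le_trans _ IH) // divr_ge0 // ltW.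
  have sx : s^-1 <= (x ^+ 2)^-1.
    rewrite lef_pV2 ?posrE ?exprn_gt0 // -exprM muln2 -mul2n -expnS.
    by rewrite ler_weXn2l // leq_exp2l.
  rewrite (exprD h) -/x -expr2; move: sq sx; rewrite expr_div_n.
  have b0 : 0 <= (x ^+ 2)^-1 by rewrite invr_ge0 exprn_ge0 // ltW.
  move: (s^-1) ((x ^+ 2)^-1) (walk_corr (2 ^ j) ^+ 2) (walk_corr (2 ^ j + 2 ^ j)) b0 => a b y z b0.
  by lra.
have := dbl k (leqnn k); rewrite -/s => lo.
have hi := walk_corr_bound (2 ^ k).
have T0 : 0 <= \sum_v deg v * dot (heat (2 ^ k) v) (heat (2 ^ k) v).
  by apply: sumr_ge0 => v _; rewrite mulr_ge0 ?deg_ge0 // dot_ge0 // => u; apply: heat_ge0.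
have s'0 : 0 < s^-1 by rewrite invr_gt0.
have tr := heat_trace lam0 s'0 sse (2 ^ k) l12 d1.
have r0 : \sum_u \sum_v deg u * deg v * K u v <= r.
  rewrite -[leRHS]mul1r -d1 mulr_suml; apply: ler_sum => u _.
  under eq_bigr do rewrite -mulrA.
  by rewrite -mulr_sumr ler_wpM2l ?deg_ge0.
have k0 : 0 <= \sum_u \sum_v deg u * deg v * K u v.
  apply: sumr_ge0 => u _; apply: sumr_ge0 => v _.
  by rewrite !mulr_ge0 ?deg_ge0 //; case/andP: (K01 u v).
have : walk_corr (2 ^ k) ^+ 2 < 4 / s ^+ 2.
  apply: le_lt_trans num; apply: (le_trans hi).
  apply: ler_pM => //; apply: (le_trans tr).
  by rewrite invfM invrK mulrA [2 / lam * s]mulrAC.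
rewrite ltNge => /negP; apply.
have -> : 4 / s ^+ 2 = (2 / s) ^+ 2 by field; rewrite gt_eqF.
by rewrite ler_sqr ?nnegrE // ?(le_trans _ lo) // divr_ge0 // ltW.
Qed.

End Correlation.
End Walk.

(** * Partition into expanding pieces *)

Section Decomposition.
Variables (R : realType) (n : nat) (W : 'I_n -> 'I_n -> R).
Hypothesis W0 : forall u v, 0 <= W u v.
Hypothesis Wsym : forall u v, W u v = W v u.
Hypothesis W1 : \sum_u \sum_v W u v = 1.
Implicit Types f : {ffun 'I_n -> 'I_n.+1}.

Definition inner f c u v : R := W u v * ((f u == c) && (f v == c))%:R.
Definition inner_weight f c : R := \sum_u \sum_v inner f c u v.

Lemma inner_ge0 f c u v : 0 <= inner f c u v.
Proof. by rewrite mulr_ge0. Qed.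

Lemma inner_sym f c u v : inner f c u v = inner f c v u.
Proof. by rewrite /inner Wsym andbC. Qed.

Lemma inner_weight_ge0 f c : 0 <= inner_weight f c.
Proof. by apply: sumr_ge0 => u _; apply: sumr_ge0 => v _; apply: inner_ge0. Qed.

Lemma inner_weight_le1 f c : inner_weight f c <= 1.
Proof.
rewrite -W1; apply: ler_sum => u _; apply: ler_sum => v _.
by rewrite ler_piMr // lern1 leq_b1.
Qed.

Variables (s M : R) (J : nat).
Hypotheses (s1 : 1 <= s) (M1 : 1 <= M).

(* [M] to the number of scales [s ^- j], [1 <= j <= J], that are at least
   [x]: a capped step-function version of a small negative power of [x]. *)
Definition psi (x : R) : R := \prod_(j < J) (if x <= s ^- j.+1 then M else 1).

Let psi_factor x y (m : nat) : x <= y ->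
  0 <= (if y <= s ^- m then M else 1) <= (if x <= s ^- m then M else 1).
Proof.
move=> xy; have M0 : 0 <= M by apply: le_trans M1.
case: ifP => [ym|_]; first by rewrite (le_trans xy ym) M0 lexx.
by case: ifP => _; rewrite ler01 ?lexx ?M1.
Qed.

Lemma psi_ge1 x : 1 <= psi x.
Proof.
apply: (@le_trans _ _ (\prod_(j < J) 1)); first by rewrite big1.
by apply: ler_prod => j _; rewrite ler01; case: ifP => _; rewrite ?lexx.
Qed.

Lemma psi_le x : psi x <= M ^+ J.
Proof.
have -> : M ^+ J = \prod_(j < J) M by rewrite prodr_const card_ord.
apply: ler_prod => j _; case: ifP => _; rewrite ?lexx ?ler01 ?andbT //.
exact: le_trans M1.
Qed.

Lemma psi_antitone x y : x <= y -> psi y <= psi x.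
Proof. by move=> xy; apply: ler_prod => j _; apply: psi_factor. Qed.

Lemma psi_jump x y : x <= y / s -> y <= 1 -> s ^- J < y -> M * psi y <= psi x.
Proof.
move=> xy y1; rewrite /psi; case: J => [|J'] yJ.
  by move: yJ; rewrite expr0 invr1 ltNge y1.
have s0 : 0 < s by apply: lt_le_trans s1.
rewrite big_ord_recr big_ord_recl /= [y <= _]leNgt yJ mulr1.
rewrite (_ : x <= s ^- 1); last first.
  by apply: (le_trans xy); rewrite expr1 ler_piMl // invr_ge0 ltW.
rewrite ler_wpM2l //; first exact: le_trans M1.
apply: ler_prod => j _; rewrite /bump /= add1n.
have M0 : 0 <= M by apply: le_trans M1.
case: (boolP (y <= s ^- j.+1)) => [yj|_]; last first.
  by rewrite ler01; case: ifP => _; rewrite ?lexx.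
rewrite (_ : x <= _) ?M0 ?lexx //; apply: (le_trans xy).
by rewrite [s ^+ j.+2]exprSr invfM ler_wpM2r // invr_ge0 ltW.
Qed.

Lemma unused_label f : exists c, forall u, f u != c.
Proof.
have [c cf|all] := pickP (fun c => c \notin codom f).
  exists c => u; apply/eqP => e; case/negP: cf; apply/codomP; by exists u.
have : (#|'I_n.+1| <= #|codom f|)%N.
  apply/subset_leq_card/subsetP => c _.
  by have := all c => /negbFE.
by move/leq_trans/(_ (leq_image_card _ _)); rewrite !card_ord ltnn.
Qed.

Definition potential f : R :=
  \sum_c inner_weight f c * psi (inner_weight f c).

(* If [B] violated the conclusion, making it a separate class would increase
   [potential]: the edges inside [B] gain a factor [M]. *)
Lemma expanding_partition :
  exists f : {ffun 'I_n -> 'I_n.+1},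
    M ^- J <= \sum_c inner_weight f c /\
    forall c, s ^- J < inner_weight f c -> forall B : {set 'I_n},
      \sum_(u in B) \sum_v inner f c u v <= inner_weight f c / s ->
      M * (\sum_(u in B) \sum_(v in B) inner f c u v) <=
      2 * \sum_(u in B) \sum_v inner f c u v.
Proof.
pose f0 : {ffun 'I_n -> 'I_n.+1} := [ffun => ord0].
have M0 : 0 < M by apply: lt_le_trans M1.
have s0 : 0 < s by apply: lt_le_trans s1.
have [f _ fmax] := @arg_maxP _ _ _ f0 xpredT potential isT.
have {}fmax g : potential g <= potential f by apply: fmax.
exists f; split.
  have e0 : inner_weight f0 ord0 = 1.
    rewrite -W1; apply: eq_bigr => u _; apply: eq_bigr => v _.
    by rewrite /inner !ffunE eqxx mulr1.
  have : 1 <= potential f.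
    apply: le_trans (fmax f0); rewrite /potential (bigD1 ord0) //= e0 mul1r.
    rewrite -[leLHS]addr0 lerD ?psi_ge1 //; apply: sumr_ge0 => c _.
    by rewrite mulr_ge0 ?inner_weight_ge0 // (le_trans _ (psi_ge1 _)).
  move=> h; rewrite -[leLHS]mul1r ler_pdivrMr ?exprn_gt0 //; apply: (le_trans h).
  rewrite mulr_suml; apply: ler_sum => c _.
  by rewrite ler_wpM2l ?inner_weight_ge0 // psi_le.
move=> c; set E := inner_weight f c => EJ B; set b := \sum_(u in B) _ => bE.
set eB := \sum_(u in B) _.
have [c' fc'] := unused_label f.
have cc' u : f u = c -> c != c' by move=> <-.
pose g : {ffun 'I_n -> 'I_n.+1} :=
  [ffun u => if (u \in B) && (f u == c) then c' else f u].
have gc' u : (g u == c') = (u \in B) && (f u == c).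
  by rewrite ffunE; case: ifP => _; rewrite ?eqxx // (negPf (fc' u)).
have gc u : (g u == c) = (u \notin B) && (f u == c).
  rewrite ffunE; case: (boolP (u \in B)) => //= uB.
  case: (boolP (f u == c)) => [/eqP/cc'|/negPf-> //].
  by rewrite eq_sym => /negPf.
have gd d u : d != c -> d != c' -> (g u == d) = (f u == d).
  move=> dc dc'; rewrite ffunE; case: ifP => // /andP[_ /eqP->].
  by rewrite eq_sym (negPf dc') eq_sym (negPf dc).
have gB : inner_weight g c' = eB.
  rewrite /eB big_mkcond; apply: eq_bigr => u _; rewrite /inner.
  case: (boolP (u \in B)) => uB.
    rewrite [RHS]big_mkcond; apply: eq_bigr => v _; rewrite !gc' uB /=.
    by case: (v \in B) => //=; rewrite andbF mulr0.
  by rewrite big1 // => v _; rewrite !gc' (negPf uB) mulr0.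
have eB0 : 0 <= eB by rewrite -gB inner_weight_ge0.
have eBb : eB <= b.
  apply: ler_sum => u _; rewrite big_mkcond; apply: ler_sum => v _.
  by case: ifP => _; rewrite ?inner_ge0.
have gA : E - 2 * b <= inner_weight g c.
  have -> : 2 * b = \sum_u \sum_v ((u \in B)%:R + (v \in B)%:R) * inner f c u v.
    transitivity (b + \sum_u \sum_v (v \in B)%:R * inner f c u v).
      rewrite mulr_natl mulr2n; congr (_ + _).
      rewrite exchange_big /= /b big_mkcond; apply: eq_bigr => u _.
      rewrite -mulr_sumr; case: ifP => _; rewrite ?mul0r // mul1r.
      by apply: eq_bigr => v _; rewrite inner_sym.
    rewrite /b big_mkcond -big_split; apply: eq_bigr => u _ /=.
    under [RHS]eq_bigr do rewrite mulrDl.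
    rewrite big_split /= -mulr_sumr.
    by case: ifP => _; rewrite ?mul1r ?mul0r.
  rewrite /E -sumrB; apply: ler_sum => u _; rewrite -sumrB; apply: ler_sum => v _.
  have w0 := W0 u v; rewrite /inner !gc.
  case: (u \in B); case: (v \in B); case: (f u == c); case: (f v == c);
    rewrite /= ?mulr1 ?mulr0 ?mul0r; lra.
have cc : c' != c.
  apply/eqP => e; move: EJ; rewrite /E -e ltNge => /negP; apply.
  rewrite (_ : inner_weight f c' = 0) ?invr_ge0 ?exprn_ge0 // ?ltW //.
  rewrite /inner_weight big1 // => u _; rewrite big1 // => v _.
  by rewrite /inner (negPf (fc' u)) mulr0.
have fc0 : inner_weight f c' = 0.
  rewrite /inner_weight big1 // => u _; rewrite big1 // => v _.
  by rewrite /inner (negPf (fc' u)) mulr0.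
have := fmax g; rewrite /potential.
rewrite (bigD1 c) //= (bigD1 c') //= [leRHS](bigD1 c) //= [X in _ <= _ + X](bigD1 c') //=.
rewrite fc0 mul0r add0r addrA.
rewrite (eq_bigr (fun d => inner_weight f d * psi (inner_weight f d))); last first.
  move=> d /andP[dc dc']; rewrite (_ : inner_weight g d = inner_weight f d) //.
  apply: eq_bigr => u _; apply: eq_bigr => v _.
  by rewrite /inner !gd.
rewrite lerD2r gB -/E => le.
have pE : 0 < psi E by apply: lt_le_trans (psi_ge1 _).
have p1 : (E - 2 * b) * psi E <= inner_weight g c * psi (inner_weight g c).
  apply: (@le_trans _ _ (inner_weight g c * psi E)).
    by rewrite ler_pM2r.
  rewrite ler_wpM2l ?inner_weight_ge0 //; apply: psi_antitone.
  apply: ler_sum => u _; apply: ler_sum => v _; rewrite /inner !gc ler_wpM2l //.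
  rewrite ler_nat; case: (u \in B); case: (v \in B);
  by case: (f u == c); case: (f v == c).
have p2 : eB * (M * psi E) <= eB * psi eB.
  rewrite ler_wpM2l // psi_jump // ?inner_weight_le1 //.
  exact: le_trans bE.
have : (M * eB) * psi E <= (2 * b) * psi E by nra.
by rewrite ler_pM2r.
Qed.

End Decomposition.

(** * Pseudodistributions on global assignments *)

Lemma superset_card (n t : nat) (S : {set 'I_n}) :
  (#|S| <= t <= n)%N -> exists2 U : {set 'I_n}, #|U| = t & S \subset U.
Proof.
move=> /andP[St tn]; have {tn St} : (#|S| + (t - #|S|) <= n)%N /\
    t = (#|S| + (t - #|S|))%N by rewrite subnKC.
move: (t - #|S|)%N => m [le ->]; elim: m le => [|m IH] le.
  by exists S; rewrite ?addn0.
rewrite addnS in le; have [U cU sU] := IH (ltnW le).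
have : (0 < #|~: U|)%N.
  by rewrite -(ltn_add2l #|U|) cardsC card_ord addn0 cU.
case/card_gt0P => x; rewrite inE => xU.
exists (x |: U); first by rewrite cardsU1 xU cU addnS add1n.
exact: subset_trans sU (subsetUr _ _).
Qed.

Section Extension.
Variables (R : realType) (n q t : nat) (a0 : 'I_q).
Variable mu : forall S : {set 'I_n}, local_asg q S -> R.
Hypotheses (mu_pd : is_pseudodist t mu) (tn : (t <= n)%N).
Local Notation Omega := {ffun 'I_n -> 'I_q}.

Definition extend (S : {set 'I_n}) (y : local_asg q S) : Omega :=
  [ffun i => if insub i is Some u then y u else a0].

Lemma extendE (S : {set 'I_n}) (y : local_asg q S) (u : {i | i \in S}) :
  extend y (val u) = y u.
Proof. by rewrite ffunE valK. Qed.

Definition super (S : {set 'I_n}) : {set 'I_n} :=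
  if [pick U : {set 'I_n} | (#|U| == t) && (S \subset U)] is Some U then U
  else S.

Lemma superP (S : {set 'I_n}) : (#|S| <= t)%N ->
  #|super S| = t /\ S \subset super S.
Proof.
move=> St; rewrite /super; case: pickP => [U /andP[/eqP-> ->] //|none].
have [|U cU sU] := @superset_card n t S; first by rewrite St.
by have := none U; rewrite cU eqxx sU.
Qed.

Definition globalize (S : {set 'I_n}) (x : Omega) : R :=
  \sum_(y : local_asg q (super S)) mu y * (extend y == x)%:R.

Lemma ex_globalize (S : {set 'I_n}) (F : Omega -> R) :
  ex (globalize S) F = \sum_(y : local_asg q (super S)) mu y * F (extend y).
Proof.
rewrite /ex /globalize; under eq_bigr do rewrite mulr_suml.
rewrite exchange_big; apply: eq_bigr => y _.
by under eq_bigr do rewrite -mulrA; rewrite -mulr_sumr sum_indic.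
Qed.

Lemma ex_marginal (S T : {set 'I_n}) (F : Omega -> R) :
  T \subset super S -> local T F ->
  ex (globalize S) F =
  \sum_(w : local_asg q T) marginal (mu (S := super S)) w * F (extend w).
Proof.
move=> sT lF; rewrite ex_globalize /marginal.
under [RHS]eq_bigr do rewrite big_mkcond mulr_suml.
rewrite exchange_big /=; apply: eq_bigr => y _.
pose w : local_asg q T :=
  [ffun v => y (exist _ (val v) (subsetP sT _ (valP v)))].
rewrite (bigD1 w) //= big1 ?addr0 => [|w' nw].
  have -> : agree y w.
    apply/forallP => u; apply/forallP => v; apply/implyP => /eqP uv.
    by rewrite ffunE; apply/eqP; congr (y _); apply: val_inj.
  congr (_ * _); apply: lF; apply/forall_inP => i iT.
  pose v : {i | i \in T} := exist _ i iT.
  pose u : {i | i \in super S} := exist _ i (subsetP sT _ iT).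
  have -> : extend y i = y u := extendE y u.
  have -> : extend w i = w v := extendE w v.
  by rewrite /w ffunE; apply/eqP; congr (y _); apply: val_inj.
case: ifP => [ag|_]; last by rewrite mul0r.
case/eqP: nw; apply/ffunP => v; rewrite ffunE; apply/eqP; rewrite eq_sym.
by move/forallP: ag => /(_ (exist _ (val v) (subsetP sT _ (valP v))))
  /forallP/(_ v)/implyP; apply.
Qed.

Lemma globalize_pseudodist : pseudodist t globalize.
Proof.
split=> [S cS|S S' T F cS cS' sT sT' lF].
  have [cU sU] := superP cS; have [m0 m1] := mu_pd.1 _ cU.
  split=> [x|]; first by apply: sumr_ge0 => y _; rewrite mulr_ge0.
  have := ex_globalize S (fun=> 1); rewrite /ex.
  under eq_bigr do rewrite mulr1; move=> ->.
  by under eq_bigr do rewrite mulr1.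
have [cU sU] := superP cS; have [cU' sU'] := superP cS'.
have sTU := subset_trans sT sU; have sTU' := subset_trans sT' sU'.
rewrite !(ex_marginal (T := T)) //; apply: eq_bigr => w _.
by rewrite (mu_pd.2 _ (super S')).
Qed.

Lemma pair_prob_globalize (i j : 'I_n) (Q : 'I_q -> 'I_q -> bool) :
  (1 < t)%N ->
  pair_prob t mu i j Q =
  ex (globalize [set i; j]) (fun x => (Q (x i) (x j))%:R).
Proof.
move=> t2; have cS : (#|[set i; j]| <= t)%N.
  by rewrite cards2; apply: leq_trans t2; case: (i != j).
have [cU sU] := superP cS.
rewrite (ex_marginal (T := [set i; j])) //; last first.
  move=> x z /forall_inP xz.
  by rewrite (eqP (xz i (set21 _ _))) (eqP (xz j (set22 _ _))).
rewrite /pair_prob big_mkcond; apply: eq_bigr => w _.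
rewrite (local_marginalE mu_pd cU sU).
have -> : extend w i = w (exist _ i (set21 i j)) :=
  extendE w (exist (fun k => k \in [set i; j]) i (set21 i j)).
have -> : extend w j = w (exist _ j (set22 i j)) :=
  extendE w (exist (fun k => k \in [set i; j]) j (set22 i j)).
by case: ifP => _; rewrite ?mulr1 ?mulr0.
Qed.

End Extension.

Section OrderedWeights.
Variables (R : realType) (n q : nat) (I : csp R n q).

(* Half of each edge weight on either orientation, so that ordered sums
   replace the sums over [i < j]. *)
Definition half_weight (i j : 'I_n) : R :=
  if edge I i j then weight I i j / 2 else 0.

Lemma half_weight_ge0 i j : 0 <= half_weight i j.
Proof.
by rewrite /half_weight; case: ifP => // /weight_ge0 w0; rewrite divr_ge0.
Qed.

Lemma half_weight_sym i j : half_weight i j = half_weight j i.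
Proof.
rewrite /half_weight (edge_sym I); case: ifP => // e.
by rewrite (weight_sym e).
Qed.

Lemma half_weight_diag i : half_weight i i = 0.
Proof. by rewrite /half_weight (edge_irr I). Qed.

Lemma half_weight_edge i j : 0 < half_weight i j -> edge I i j.
Proof. by rewrite /half_weight; case: ifP => //; rewrite ltxx. Qed.

Lemma half_weight_sum (g : 'I_n -> 'I_n -> R) :
  (forall i j, edge I i j -> g i j = g j i) ->
  \sum_i \sum_j half_weight i j * g i j =
  \sum_(i < n) \sum_(j < n | (i < j)%N && edge I i j) weight I i j * g i j.
Proof.
move=> gs; pose F i j := half_weight i j * g i j.
have Fs i j : F i j = F j i.
  rewrite /F half_weight_sym /half_weight.
  by case: ifP => [/gs->|_]; rewrite ?mul0r.
pose A := \sum_(i < n) \sum_(j < n) (i < j)%N%:R * F i j.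
have e : \sum_i \sum_j half_weight i j * g i j = A + A.
  rewrite /A [X in _ = _ + X]exchange_big -big_split; apply: eq_bigr => i _ /=.
  rewrite -big_split; apply: eq_bigr => j _ /=; rewrite -/(F i j) [F j i]Fs.
  have [lt|lt|/val_inj ij] := ltngtP i j; rewrite ?mul1r ?mul0r ?addr0 ?add0r //.
  by rewrite ij /F half_weight_diag mul0r.
rewrite e -big_split; apply: eq_bigr => i _ /=.
rewrite -big_split [RHS]big_mkcond; apply: eq_bigr => j _ /=.
rewrite /F /half_weight; case: (i < j)%N; rewrite ?mul0r ?addr0 //= !mul1r.
by case: ifP => _; [field|rewrite mul0r addr0].
Qed.

Lemma half_weight_sum1 : \sum_i \sum_j half_weight i j = 1.
Proof.
have := half_weight_sum (g := fun _ _ => 1) (fun _ _ _ => erefl).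
under eq_bigr => i _ do under eq_bigr => j _ do rewrite mulr1.
move=> ->; rewrite -[RHS](weight_sum1 I); apply: eq_bigr => i _.
by under eq_bigr do rewrite mulr1.
Qed.

Lemma csp_valueE x : csp_value I x = value half_weight (constr I) x.
Proof.
rewrite /value (half_weight_sum (g := fun i j => (constr I i j (x i) (x j))%:R)) //.
by move=> i j e; rewrite (constr_sym _ _ e).
Qed.

Lemma le_csp_opt x : csp_value I x <= csp_opt I.
Proof. by rewrite /csp_opt; apply: le_bigmax_cond. Qed.

End OrderedWeights.

(** * Rounding a piece *)

Section Advantage.
Variables (R : realType) (n q : nat).
Local Notation Omega := {ffun 'I_n -> 'I_q}.
Variables (W : 'I_n -> 'I_n -> R) (C : 'I_n -> 'I_n -> 'I_q -> 'I_q -> bool).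
Hypothesis W0 : forall i j, 0 <= W i j.
Hypothesis Wsym : forall i j, W i j = W j i.
Hypothesis Wii : forall i, W i i = 0.
Hypothesis W1 : \sum_i \sum_j W i j = 1.
Hypothesis q0 : (0 < q)%N.
Variables (t : nat) (D : {set 'I_n} -> Omega -> R).
Hypothesis pdD : pseudodist t D.

Definition sat_prob i j : R :=
  ex (D [set i; j]) (fun x => (C i j (x i) (x j))%:R).

Definition cond_marginal (T : {set 'I_n}) (z : Omega) i a : R := cexp (D (i |: T)) T (ind R i a) z.

Lemma cond_marginal_dist (T : {set 'I_n}) z i : (#|T| < t)%N -> 0 < D T z ->
  is_dist (cond_marginal T z i).
Proof.
move=> cT mz; have cU : (#|i |: T| <= t)%N by apply: leq_trans (cardsU1_leq _ _) cT.
have [m0 m1] := pdD.1 _ cU.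
split=> [a|]; first by apply: cexp_ge0 => // x; apply: ind_ge0.
rewrite /cond_marginal -cexp_sum.
rewrite (_ : (fun x => _) = fun=> 1); last first.
  apply/funext => x; have := sum_indic (x i) (fun=> 1 : R).
  by under eq_bigr do rewrite mulr1.
rewrite (@cexp_pd _ _ _ _ _ pdD _ T T finset.set0) ?finset.setU0 ?subsetUr //; last first.
  exact: ltnW.
by apply: cexp_cst => //; apply: (pdD.1 _ (ltnW cT)).1.
Qed.

Lemma sat_prob01 i j : (1 < t)%N -> 0 <= sat_prob i j <= 1.
Proof.
move=> t2; have [m0 m1] : is_dist (D [set i; j]).
  by apply: pdD.1; rewrite cards2; apply: leq_trans t2; case: (_ != _).
rewrite ex_ge0 //= ex_le_const // => x; first by rewrite lern1 leq_b1.
Qed.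

Lemma indep_prob_avg (T : {set 'I_n}) i j beta : (#|T| + 2 <= t)%N -> 0 < beta ->
  sat_prob i j - (gcorr D T i j / (2 * beta) + (q ^ 2)%:R * beta / 2) <=
  ex (D T) (fun z => indep_prob C (cond_marginal T z) i j).
Proof.
move=> cT b0; set S := i |: (j |: T).
have cS : (#|S| <= t)%N.
  by apply: leq_trans (cardsU2_leq _ _ _) _; rewrite -addn2.
have [m0 m1] := pdD.1 _ cS.
have cT' : (#|T| <= t)%N by apply: leq_trans cT; apply: leq_addr.
have TS : T \subset S by rewrite /S setUA subsetUr.
have iS : i |: T \subset S by rewrite /S setUCA subsetUr.
have jS : j |: T \subset S by rewrite /S subsetUr.
pose e (a b : 'I_q) (x : Omega) := ind R i a x * ind R j b x.
have -> : ex (D T) (fun z => indep_prob C (cond_marginal T z) i j) =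
  ex (D S) (fun z => \sum_a \sum_b (C i j a b)%:R *
     (cexp (D S) T (e a b) z - cov (D S) T (ind R i a) (ind R j b) z)).
  rewrite (pdD.2 T S T) //; last first.
    move=> x z xz; apply: eq_bigr => a _; apply: eq_bigr => b _.
    by rewrite /cond_marginal; congr (_ * _ * _); apply: local_cexp.
  apply: ex_eq => z; apply: eq_bigr => a _; apply: eq_bigr => b _.
  have E k c : k |: T \subset S -> cond_marginal T z k c = cexp (D S) T (ind R k c) z.
    move=> kS; have ck := leq_trans (subset_leq_card kS) cS.
    apply: (@cexp_pd _ _ _ _ _ pdD _ _ T [set k]); rewrite // 1?setUC //.
    by apply: local_ind; rewrite set11.
  by rewrite !E // /cov mulrC; congr (_ * _); rewrite opprB addrC subrK.
have -> : sat_prob i j =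
    ex (D S) (fun z => \sum_a \sum_b (C i j a b)%:R * cexp (D S) T (e a b) z).
  rewrite /sat_prob (pdD.2 _ S [set i; j]) //; last 3 first.
  - by rewrite cards2; apply: leq_trans cT; rewrite addn2; case: (_ != _).
  - by rewrite /S setUA subsetUl.
  - move=> x z /forall_inP xz.
    by rewrite (eqP (xz i (set21 _ _))) (eqP (xz j (set22 _ _))).
  transitivity (ex (D S) (fun z => \sum_a \sum_b (C i j a b)%:R * e a b z)).
    apply: ex_eq => x; rewrite -(sum_indic (x i) (fun a => (C i j a (x j))%:R)).
    apply: eq_bigr => a _; rewrite -(sum_indic (x j) (fun b => (C i j a b)%:R)).
    by rewrite mulr_sumr; apply: eq_bigr => b _; rewrite /e /ind; ring.
  rewrite !ex_sum; apply: eq_bigr => a _; rewrite !ex_sum; apply: eq_bigr => b _.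
  rewrite !exZ; congr (_ * _).
  have := @tower _ _ _ (D S) m0 T (e a b) (fun=> 1).
  rewrite (@ex_eq _ _ _ _ _ (cexp (D S) T (e a b))); last by move=> z; rewrite mulr1.
  by move=> ->; [apply: ex_eq => z; rewrite mulr1|].
rewrite (gcorrE pdD cS cS) //.
have -> : (q ^ 2)%:R * beta / 2 = ex (D S) (fun=> (q ^ 2)%:R * beta / 2).
  by rewrite /ex -mulr_suml m1 mul1r.
rewrite -[_ / (2 * beta)]mulrC -exZ -exD -[X in _ - X]mul1r -mulNr -exZ -exD.
apply: ler_ex => // z.
have -> : (q ^ 2)%:R * beta / 2 = \sum_(a < q) \sum_(b < q) beta / 2.
  by rewrite !sumr_const !card_ord -mulrnA mulnn -[RHS]mulr_natl mulrA.
rewrite mulN1r /corr mulr_sumr -big_split -sumrB; apply: ler_sum => a _ /=.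
rewrite mulr_sumr -big_split -sumrB; apply: ler_sum => b _ /=.
rewrite mulrBr lerD2l lerN2.
set x := cov _ _ _ _ _.
have x0 : x <= (2 * beta)^-1 * x ^+ 2 + beta / 2.
  rewrite -subr_ge0 (_ : _ - _ = (2 * beta)^-1 * (x - beta) ^+ 2); last first.
    by field; rewrite gt_eqF.
  by rewrite mulr_ge0 ?sqr_ge0 // invr_ge0 mulr_ge0 // ltW.
case: (C i j a b); rewrite ?mul1r // mul0r addr_ge0 //.
  by rewrite mulr_ge0 ?sqr_ge0 // invr_ge0 mulr_ge0 // ltW.
by rewrite divr_ge0 // ltW.
Qed.

(* [s = h ^ (2 ^ k)] is the scale; [h = 8 q^8] makes the correlation loss on
   the edges of a piece at most [1 / (2 q^2)]. *)
Lemma piece_rounding (f : {ffun 'I_n -> 'I_n.+1}) c (k d : nat) (lam : R) :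
  let s := ((8 * q ^ 8) ^ (2 ^ k))%N in
  (s ^ 4 + s + 2 <= t)%N -> (n <= s ^ (2 * d))%N ->
  lam^-1 = 4 * (8 * q ^ 8)%:R ^+ (2 * d) -> lam^-1 <= s%:R ->
  (0 < d)%N ->
  0 < inner_weight W f c ->
  (forall B : {set 'I_n},
     \sum_(u in B) \sum_v inner W f c u v <= inner_weight W f c / s%:R ->
     lam ^- 2 * (\sum_(u in B) \sum_(v in B) inner W f c u v) <=
     2 * \sum_(u in B) \sum_v inner W f c u v) ->
  exists2 p : 'I_n -> 'I_q -> R, (forall i, is_dist (p i)) &
    \sum_i \sum_j inner W f c i j * sat_prob i j
      - inner_weight W f c / (2 * q%:R ^+ 2) <=
    \sum_i \sum_j inner W f c i j * indep_prob C p i j.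
Proof.
move=> s st ns lamE lams d0 E0 sse; set E := inner_weight W f c in E0 sse *.
have h8 : (8 <= 8 * q ^ 8)%N by rewrite leq_pmulr // expn_gt0 q0.
have hR : 8 <= (8 * q ^ 8)%:R :> R by rewrite ler_nat.
have s1 : (1 <= s)%N by rewrite expn_gt0 (leq_trans _ h8).
have s0 : 0 < s%:R :> R by rewrite ltr0n.
have qR : 1 <= q%:R :> R by rewrite ler1n.
have qR0 : 0 < q%:R :> R by rewrite ltr0n.
have lam0 : 0 < lam.
  rewrite -invr_gt0 lamE mulr_gt0 // exprn_gt0 //; lra.
pose Wc u v := inner W f c u v / E.
have Wc0 u v : 0 <= Wc u v by rewrite divr_ge0 ?inner_ge0 // ltW.
have Wcs u v : Wc u v = Wc v u by rewrite /Wc inner_sym.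
have degE u : deg Wc u = (\sum_v inner W f c u v) / E by rewrite mulr_suml.
have deg1 : \sum_u deg Wc u = 1.
  under eq_bigr do rewrite degE.
  by rewrite -mulr_suml divff // gt_eqF.
have ddist : is_dist (deg Wc) by split=> // u; apply: deg_ge0.
have r0 : (0 < s ^ 4)%N by rewrite expn_gt0 s1.
have rt : (s ^ 4 + 2 <= t)%N.
  by apply: leq_trans st; rewrite leq_add2r leq_addr.
have [T cT glob] := conditioning pdD r0 rt ddist.
have T2 : (#|T| + 2 <= t)%N by apply: leq_trans rt; rewrite leq_add2r.
pose K u v := gcorr D T u v / (q ^ 2)%:R.
have q2 : 0 < (q ^ 2)%:R :> R by rewrite ltr0n expn_gt0 q0.
have g0 u v : 0 <= gcorr D T u v := gcorr_ge0 pdD u v T2.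
have K01 u v : 0 <= K u v <= 1.
  by rewrite divr_ge0 //= ler_pdivrMr // mul1r (gcorr_le pdD).
have edge : \sum_u \sum_v Wc u v * K u v <= 2 / (8 * q ^ 8)%:R.
  apply: (@edge_corr_bound _ _ Wc Wc0 Wcs K K01 deg1 _ lam k (s ^ 4)%:R^-1);
    rewrite -?natrX -/s //.
  - by apply: le_trans hR; rewrite ler_nat.
  - have : 8 <= lam^-1.
      rewrite lamE; have : 1 <= (8 * q ^ 8)%:R ^+ (2 * d) :> R.
        by apply: exprn_ege1; lra.
      have : (8 * q ^ 8)%:R <= (8 * q ^ 8)%:R ^+ (2 * d) :> R.
        by rewrite ler_eXnr ?muln_gt0 //; lra.
      lra.
    move=> l8; have : 8 * lam <= 1 by rewrite -ler_pdivlMr // mul1r.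
    lra.
  - move=> B; under eq_bigr do rewrite degE.
    rewrite -mulr_suml ler_pdivrMr // [_^-1 * E]mulrC => /sse h.
    have -> : \sum_(u in B) \sum_(v in B) Wc u v =
       (\sum_(u in B) \sum_(v in B) inner W f c u v) / E.
      by rewrite mulr_suml; apply: eq_bigr => u _; rewrite mulr_suml.
    rewrite mulrA ler_pM2r ?invr_gt0 //.
    rewrite -(ler_pM2l (_ : 0 < lam ^- 2)) ?invr_gt0 ?exprn_gt0 //.
    apply: le_trans h _; rewrite le_eqVlt; apply/orP; left; apply/eqP.
    by field; rewrite gt_eqF.
  - move=> v rho a rhod.
    have cs : (#|T| + s.+1 <= t)%N.
      apply: leq_trans st; rewrite -addnA leq_add // addn2 ltnS; exact: leqnSn.
    have := gcorr_walk pdD v a s1 cs rhod.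
    rewrite -(pmulr_rge0 _ (_ : 0 < (q ^ 2)%:R^-1)) ?invr_gt0 //.
    move=> h; apply: le_trans h _; rewrite le_eqVlt; apply/orP; left; apply/eqP.
    have -> : \sum_w rho w * K v w = (\sum_w rho w * gcorr D T v w) / (q ^ 2)%:R.
      by rewrite mulr_suml; apply: eq_bigr => w _; rewrite mulrA.
    have -> : \sum_w \sum_w' rho w * rho w' * K w w' =
       (\sum_w \sum_w' rho w * rho w' * gcorr D T w w') / (q ^ 2)%:R.
      rewrite mulr_suml; apply: eq_bigr => w _.
      by rewrite mulr_suml; apply: eq_bigr => w' _; rewrite mulrA.
    by rewrite /K; field; rewrite !gt_eqF.
  - move=> u; have := glob u; apply: le_trans; apply: ler_sum => v _.
    rewrite ler_wpM2l ?deg_ge0 // ler_pdivrMr // ler_peMr //.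
    by rewrite ler1n expn_gt0 q0.
  - rewrite card_ord.
    have -> : 4 * lam = ((8 * q ^ 8)%:R ^+ (2 * d))^-1.
      by rewrite -[lam]invrK lamE; field; rewrite expf_neq0 ?gt_eqF //; lra.
    have lo : ((8 * q ^ 8)%:R ^+ (2 * d))^-1 ^+ (2 ^ k) * n%:R <= 1 :> R.
      rewrite exprVn -exprM (mulnC (2 * d)) exprM -natrX -/s mulrC ler_pdivrMr ?exprn_gt0 //.
      by rewrite mul1r -natrX ler_nat.
    have hi : 2 * s%:R / lam <= 2 * s%:R ^+ 2.
      by rewrite expr2 mulrA ler_pM2l // mulr_gt0.
    have s2 : 1 <= s%:R ^+ 2 :> R by rewrite exprn_ege1 // ler1n.
    rewrite (natrX R s 2) (natrX R s 4) ltr_pdivrMr ?exprn_gt0 //.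
    have -> : 4 / s%:R ^+ 2 * s%:R ^+ 4 = 4 * s%:R ^+ 2 :> R.
      by field; rewrite gt_eqF.
    by lra.
have corrE : \sum_u \sum_v inner W f c u v * gcorr D T u v <= E / (4 * q%:R ^+ 6).
  have -> : \sum_u \sum_v inner W f c u v * gcorr D T u v =
     (E * (q ^ 2)%:R) * \sum_u \sum_v Wc u v * K u v.
    rewrite mulr_sumr; apply: eq_bigr => u _; rewrite mulr_sumr.
    by apply: eq_bigr => v _; rewrite /Wc /K; field; rewrite !gt_eqF.
  apply: le_trans (ler_wpM2l _ edge) _; first by rewrite mulr_ge0 // ltW.
  rewrite natrM !natrX le_eqVlt; apply/orP; left; apply/eqP.
  by field; rewrite gt_eqF.
pose beta : R := (2 * q%:R ^+ 4)^-1.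
have b0 : 0 < beta by rewrite invr_gt0 mulr_gt0 // exprn_gt0.
have Tt : (#|T| < t)%N by apply: leq_trans T2; rewrite addn2.
have [m0 m1] := pdD.1 _ (ltnW Tt).
have [z mz avg] := avg_attained
  (fun z => \sum_i \sum_j inner W f c i j * indep_prob C (cond_marginal T z) i j) m0 m1.
exists (cond_marginal T z) => [i|]; first exact: cond_marginal_dist.
apply: le_trans avg; rewrite -/(ex (D T) _).
rewrite ex_sum; under [leRHS]eq_bigr do rewrite ex_sum.
apply: (@le_trans _ _ (\sum_i \sum_j inner W f c i j *
   (sat_prob i j - (gcorr D T i j / (2 * beta) + (q ^ 2)%:R * beta / 2)))); last first.
  apply: ler_sum => i _; apply: ler_sum => j _; rewrite exZ ler_wpM2l ?inner_ge0 //.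
  exact: indep_prob_avg.
have -> : \sum_i \sum_j inner W f c i j *
   (sat_prob i j - (gcorr D T i j / (2 * beta) + (q ^ 2)%:R * beta / 2)) =
   \sum_i \sum_j inner W f c i j * sat_prob i j -
   ((\sum_u \sum_v inner W f c u v * gcorr D T u v) / (2 * beta) +
    E * ((q ^ 2)%:R * beta / 2)).
  rewrite 2!mulr_suml -big_split -sumrB; apply: eq_bigr => i _ /=.
  rewrite 2!mulr_suml -big_split -sumrB; apply: eq_bigr => j _ /=.
  by ring.
rewrite lerD2l lerN2.
apply: (@le_trans _ _ (E / (4 * q%:R ^+ 6) / (2 * beta) + E * ((q ^ 2)%:R * beta / 2))).
  by rewrite lerD2r ler_pM2r // invr_gt0 mulr_gt0.
rewrite /beta natrX le_eqVlt; apply/orP; left; apply/eqP.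
by field; rewrite gt_eqF.
Qed.

End Advantage.

(** * Rounding the whole instance *)

Section Global.
Variables (R : realType) (n q : nat).
Local Notation Omega := {ffun 'I_n -> 'I_q}.
Variables (W : 'I_n -> 'I_n -> R) (C : 'I_n -> 'I_n -> 'I_q -> 'I_q -> bool).
Hypothesis W0 : forall i j, 0 <= W i j.
Hypothesis Wsym : forall i j, W i j = W j i.
Hypothesis Wii : forall i, W i i = 0.
Hypothesis W1 : \sum_i \sum_j W i j = 1.
Hypothesis q0 : (0 < q)%N.

Definition uniform (_ : 'I_n) (_ : 'I_q) : R := q%:R^-1.

Lemma uniform_dist i : is_dist (uniform i).
Proof.
split=> [a|]; first by rewrite invr_ge0.
by rewrite sumr_const card_ord -[_ *+ q]mulr_natl divff // pnatr_eq0 -lt0n.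
Qed.

Lemma indep_prob_uniform i j : indep_prob C uniform i j = pred_mean R (C i j).
Proof.
rewrite /pred_mean mulr_suml; apply: eq_bigr => a _.
by rewrite mulr_suml; apply: eq_bigr => b _; rewrite natrX -invfM mulrC -expr2.
Qed.

Lemma sum_inner (f : {ffun 'I_n -> 'I_n.+1}) i j (X : 'I_n.+1 -> R) :
  \sum_c inner W f c i j * X c = if f i == f j then W i j * X (f i) else 0.
Proof.
rewrite (bigD1 (f i)) //= big1 ?addr0 => [|c nc]; last first.
  by rewrite /inner eq_sym (negPf nc) mulr0 mul0r.
by rewrite /inner eqxx eq_sym; case: eqP; rewrite ?mulr1 ?mulr0 ?mul0r.
Qed.

Lemma uniform_value :
  exists x, \sum_i \sum_j W i j * pred_mean R (C i j) <= value W C x.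
Proof.
have [x le] := indep_rounding C Wii (fun _ _ => true) uniform_dist.
exists x; move: le; rewrite /value.
under eq_bigr => i _ do under eq_bigr => j _ do rewrite mulr1 indep_prob_uniform.
by under [X in _ <= X -> _]eq_bigr => i _ do under eq_bigr => j _ do rewrite mulr1.
Qed.

Variables (S : {set 'S_q}) (c0 : R).
Hypothesis Su : uniform_images R S.
Hypothesis SC : forall i j s a b, s \in S -> 0 < W i j ->
  C i j a b -> C i j (s a) (s b).
Hypothesis cC : forall i j, 0 < W i j -> c0 <= pred_mean R (C i j).
Hypothesis c01 : c0 <= 1 - (q%:R ^+ 2)^-1.

Lemma single_edge_advantage i j a b :
  i != j -> C i j a b -> C j i b a ->
  exists x, c0 + (1 - c0) * W i j <= value W C x.
Proof.
move=> nij Cij Cji.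
have q2 : 0 <= (q%:R ^+ 2)^-1 :> R by rewrite invr_ge0 exprn_ge0.
pose f u := if u == j then i else u.
pose p (u : 'I_n) e : R := ((if u == i then a else b) == e)%:R.
have pd u : is_dist (p u).
  split=> [e|]; first exact: ler0n.
  have := sum_indic (if u == i then a else b) (fun=> 1 : R).
  by under eq_bigr do rewrite mulr1.
have pE u v : indep_prob C p u v =
    (C u v (if u == i then a else b) (if v == i then a else b))%:R.
  rewrite /indep_prob; under eq_bigr => e _ do
    (under eq_bigr => e' _ do rewrite -mulrA; rewrite -mulr_sumr sum_indic).
  by rewrite sum_indic.
have [x le] := rounding W0 Wii f Su SC cC pd.
exists x; apply: le_trans le.
have e : \sum_u \sum_v W u v * c0 = c0.
  under eq_bigr do rewrite -mulr_suml.
  by rewrite -mulr_suml W1 mul1r.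
rewrite -{1}e; set c := c0; have c1 : c <= 1.
  by apply: le_trans c01 _; rewrite gerBl.
have v_ge u v : W u v * c <= W u v *
    (if f u == f v then indep_prob C p u v else c).
  have [->|nuv] := eqVneq u v; first by rewrite Wii !mul0r.
  rewrite ler_wpM2l //; case: ifP => // /eqP fuv.
  suff -> : indep_prob C p u v = 1 by [].
  rewrite pE; move: fuv; rewrite /f.
  have [uj|uj] := eqVneq u j; have [vj|vj] := eqVneq v j => fuv.
  - by rewrite uj vj eqxx in nuv.
  - by rewrite uj -fuv [j == i]eq_sym (negPf nij) eqxx Cji.
  - by rewrite vj fuv [j == i]eq_sym (negPf nij) eqxx Cij.
  - by rewrite fuv eqxx in nuv.
rewrite (bigD1 i) //= (bigD1 j) //= [leRHS](bigD1 i) //= [X in _ <= X + _](bigD1 j) //=.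
have -> : W i j * (if f i == f j then indep_prob C p i j else c) =
          W i j * c + (1 - c) * W i j.
  rewrite {1 2}/f eqxx (negPf nij) eqxx pE eqxx [j == i]eq_sym (negPf nij) Cij.
  by rewrite mulr1; ring.
have : \sum_(v | v != j) W i v * c <= \sum_(v | v != j) W i v *
    (if f i == f v then indep_prob C p i v else c) by apply: ler_sum => v _.
have : \sum_(u | u != i) \sum_v W u v * c <= \sum_(u | u != i) \sum_v W u v *
    (if f u == f v then indep_prob C p u v else c).
  by apply: ler_sum => u _; apply: ler_sum => v _.
by lra.
Qed.

Variables (t : nat) (D : {set 'I_n} -> Omega -> R).
Hypothesis pdD : pseudodist t D.

Lemma advantage (k d : nat) (lam : R) :
  let s := ((8 * q ^ 8) ^ (2 ^ k))%N in
  (s ^ 4 + s + 2 <= t)%N -> (n < s ^ (2 * d))%N ->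
  lam^-1 = 4 * (8 * q ^ 8)%:R ^+ (2 * d) -> lam^-1 <= s%:R ->
  (0 < d)%N -> 2 * (lam ^- 2) ^+ (2 * d).+1 <= s%:R ->
  exists x, c0 + (lam ^- 2) ^- (2 * d).+1 / (4 * q%:R ^+ 2)
     - (1 - \sum_i \sum_j W i j * sat_prob C D i j) <= value W C x.
Proof.
move=> s st ns lamE lams d0 Ms; set J := (2 * d).+1; set M := lam ^- 2.
have h8 : (8 <= 8 * q ^ 8)%N by rewrite leq_pmulr // expn_gt0 q0.
have s1 : (1 <= s)%N by rewrite expn_gt0 (leq_trans _ h8).
have s0 : 0 < s%:R :> R by rewrite ltr0n.
have qR1 : 1 <= q%:R :> R by rewrite ler1n.
have qR0 : 0 < q%:R :> R by rewrite ltr0n.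
have lam1 : 1 <= lam^-1.
  rewrite lamE; have : 1 <= (8 * q ^ 8)%:R ^+ (2 * d) :> R.
    by rewrite exprn_ege1 // ler1n (leq_trans _ h8).
  lra.
have M1 : 1 <= M by rewrite /M -exprVn exprn_ege1.
have M0 : 0 < M by apply: lt_le_trans M1.
have sR1 : 1 <= s%:R :> R by rewrite ler1n.
have t2 : (1 < t)%N by apply: leq_trans st; rewrite addn2.
have [f [tot exp]] := expanding_partition W0 Wsym W1 J sR1 M1.
pose E c := inner_weight W f c.
pose good c := s%:R ^- J < E c.
pose B c := if good c then \sum_i \sum_j inner W f c i j * sat_prob C D i j
      - E c / (2 * q%:R ^+ 2) else E c * c0.
have /choice[P HP] : forall c, exists p : 'I_n -> 'I_q -> R,
   (forall i, is_dist (p i)) /\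
   B c <= \sum_i \sum_j inner W f c i j * indep_prob C p i j.
  move=> c; rewrite /B; case: ifP => [gc|_].
    have Ec : 0 < E c.
      by apply: le_lt_trans gc; rewrite invr_ge0 exprn_ge0 // ltW.
    have [p pd le] := piece_rounding C W0 Wsym q0 pdD st (ltnW ns) lamE lams d0 Ec
      (exp c gc).
    by exists p.
  exists uniform; split; first exact: uniform_dist.
  rewrite /E /inner_weight mulr_suml; apply: ler_sum => i _.
  rewrite mulr_suml; apply: ler_sum => j _; rewrite indep_prob_uniform /inner.
  have := W0 i j; rewrite le_eqVlt => /orP[/eqP<-|/cC le]; first by rewrite !mul0r.
  by rewrite ler_wpM2l // mulr_ge0.
pose p i := P (f i) i.
have pd i : is_dist (p i) by apply: (HP _).1.
have [x le] := rounding W0 Wii f Su SC cC pd.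
exists x; apply: le_trans le.
have -> : \sum_i \sum_j W i j * (if f i == f j then indep_prob C p i j else c0) =
  \sum_c (\sum_i \sum_j inner W f c i j * indep_prob C (P c) i j)
   + c0 * (1 - \sum_c E c).
  have ex3 (F : 'I_n.+1 -> 'I_n -> 'I_n -> R) :
      \sum_c \sum_i \sum_j F c i j = \sum_i \sum_j \sum_c F c i j.
    by rewrite exchange_big; apply: eq_bigr => i _; rewrite exchange_big.
  rewrite -W1 /E /inner_weight !ex3.
  rewrite -sumrB mulr_sumr -big_split; apply: eq_bigr => i _ /=.
  rewrite -sumrB mulr_sumr -big_split; apply: eq_bigr => j _ /=.
  rewrite sum_inner.
  have -> : \sum_c inner W f c i j = if f i == f j then W i j else 0.
    have := sum_inner f i j (fun=> 1); rewrite mulr1 => <-.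
    by apply: eq_bigr => c _; rewrite mulr1.
  case: eqP => [fij|_]; last by ring.
  have -> : indep_prob C p i j = indep_prob C (P (f i)) i j.
    by rewrite /indep_prob /p -fij.
  by ring.
have sat01 i j := sat_prob01 C pdD i j t2.
pose def c := \sum_i \sum_j inner W f c i j * (1 - sat_prob C D i j).
have def0 c : 0 <= def c.
  apply: sumr_ge0 => i _; apply: sumr_ge0 => j _.
  by rewrite mulr_ge0 ?inner_ge0 // subr_ge0; case/andP: (sat01 i j).
have defE : \sum_c def c <= 1 - \sum_i \sum_j W i j * sat_prob C D i j.
  rewrite -W1 -sumrB exchange_big; apply: ler_sum => i _ /=.
  rewrite -sumrB exchange_big; apply: ler_sum => j _ /=.
  rewrite sum_inner; have /andP[_ sat1] := sat01 i j.
  case: ifP => _; first by rewrite mulrBr mulr1.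
  by rewrite subr_ge0 ler_piMr.
pose g : R := (2 * q%:R ^+ 2)^-1.
have g0 : 0 < g by rewrite invr_gt0 mulr_gt0 // exprn_gt0.
have cg : c0 <= 1 - 2 * g.
  by rewrite (_ : 2 * g = (q%:R ^+ 2)^-1) // /g; field; rewrite gt_eqF.
have E0 c : 0 <= E c by apply: inner_weight_ge0.
have pieces c : E c * c0 + (if good c then E c else 0) * g - def c <=
    \sum_i \sum_j inner W f c i j * indep_prob C (P c) i j.
  apply: le_trans (HP c).2; rewrite /B; case: ifP => _; last first.
    by rewrite mul0r addr0 gerBl.
  have -> : def c = E c - \sum_i \sum_j inner W f c i j * sat_prob C D i j.
    rewrite -sumrB; apply: eq_bigr => i _; rewrite -sumrB.
    by apply: eq_bigr => j _; ring.
  by rewrite -/g; have := E0 c; nra.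
have goodE : M ^- J / 2 <= \sum_c (if good c then E c else 0).
  have : \sum_c E c <= \sum_c ((if good c then E c else 0) + s%:R ^- J).
    apply: ler_sum => c _; have sJ : 0 < s%:R ^- J :> R by rewrite invr_gt0 exprn_gt0.
    case: ifP => [_|/negbT]; first by rewrite lerDl ltW.
    by rewrite -leNgt add0r.
  rewrite big_split sumr_const card_ord /= -[_ *+ n.+1]mulr_natl => le.
  have small : n.+1%:R * s%:R ^- J <= M ^- J / 2.
    apply: (@le_trans _ _ s%:R^-1).
      rewrite ler_pdivrMr ?exprn_gt0 // /J exprS mulKf ?gt_eqF //.
      by rewrite -natrX ler_nat.
    rewrite -invfM lef_pV2 ?posrE ?mulr_gt0 ?exprn_gt0 //.
    by rewrite mulrC.
  have := le_trans tot le; rewrite -/E -/M => tot'.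
  lra.
have : \sum_c (E c * c0 + (if good c then E c else 0) * g - def c) <=
  \sum_c (\sum_i \sum_j inner W f c i j * indep_prob C (P c) i j).
  by apply: ler_sum => c _; apply: pieces.
rewrite sumrB big_split /= -!mulr_suml => h.
have gg : M ^- J / (4 * q%:R ^+ 2) = M ^- J / 2 * g.
  by rewrite /g; move: (M ^- J) => m; field; rewrite gt_eqF.
have : M ^- J / 2 * g <= (\sum_c (if good c then E c else 0)) * g.
  by rewrite ler_pM2r.
rewrite -gg; lra.
Qed.

End Global.

(** * Conclusion *)

Section MaxP.
Variables (R : realType) (q : nat).
Hypothesis q0 : (0 < q)%N.

Let qR : 1 <= q%:R :> R. Proof. by rewrite ler1n. Qed.
Let q2 : 0 < q%:R ^+ 2 :> R. Proof. by rewrite exprn_gt0 // ltr0n. Qed.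

Lemma pred_meanE (Q : 'I_q -> 'I_q -> bool) :
  pred_mean R Q = (\sum_a \sum_b Q a b)%N%:R / q%:R ^+ 2.
Proof.
rewrite /pred_mean natrX natr_sum; congr (_ / _).
by apply: eq_bigr => a _; rewrite natr_sum.
Qed.

Lemma pred_mean_ge0 (Q : 'I_q -> 'I_q -> bool) : 0 <= pred_mean R Q.
Proof. by rewrite pred_meanE divr_ge0 // ltW. Qed.

Lemma pred_mean_sat (Q : 'I_q -> 'I_q -> bool) a b :
  Q a b -> (q%:R ^+ 2)^-1 <= pred_mean R Q.
Proof.
move=> Qab; rewrite pred_meanE.
apply: ler_peMl; first by rewrite invr_ge0 ltW.
by rewrite ler1n (bigD1 a) //= (bigD1 b) //= Qab.
Qed.

Lemma pred_mean_gt0 (Q : 'I_q -> 'I_q -> bool) :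
  0 < pred_mean R Q -> exists a b, Q a b.
Proof.
rewrite pred_meanE pmulr_lgt0 ?invr_gt0 // ltr0n => h.
have [a /existsP[b Qab]|none] := pickP (fun a => [exists b, Q a b]).
  by exists a, b.
move: h; rewrite big1 // => a _; rewrite big1 // => b _.
have /existsPn/(_ b) := negbT (none a).
by case: (Q a b).
Qed.

Variables (k : nat) (P : 'I_k -> 'I_q -> 'I_q -> bool).

Lemma min_mean_le l : min_mean R P <= pred_mean R (P l).
Proof. exact: bigmin_le_cond. Qed.

Lemma min_mean_ge0 : 0 <= min_mean R P.
Proof. by apply: le_bigmin => // l _; apply: pred_mean_ge0. Qed.

Lemma min_mean_lt1 :
  min_mean R P < 1 -> min_mean R P <= 1 - (q%:R ^+ 2)^-1.
Proof.
rewrite ltNge => c1; rewrite leNgt; apply: contra c1 => big.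
apply: le_bigmin => // l _; have := lt_le_trans big (min_mean_le l).
rewrite pred_meanE ler_pdivlMr // mul1r ltr_pdivlMr //.
rewrite mulrBl mul1r mulVf ?gt_eqF // -natrX.
rewrite -(ltrD2r 1) subrK natr1 ltr_nat ltnS => le.
by rewrite ler_nat.
Qed.

Lemma min_mean_gt0 :
  0 < min_mean R P -> (q%:R ^+ 2)^-1 <= min_mean R P.
Proof.
move=> c0; apply: le_bigmin => [|l _].
  by rewrite invf_le1 // exprn_ege1.
have /pred_mean_gt0[a [b Pab]] := lt_le_trans c0 (min_mean_le l).
exact: pred_mean_sat Pab.
Qed.

Variables (n : nat) (I : csp R n q).
Hypothesis IP : max_P P I.

Lemma max_P_mean i j : edge I i j -> min_mean R P <= pred_mean R (constr I i j).
Proof.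
move=> e; have [l [E|E]] := IP e; apply: le_trans (min_mean_le l) _.
  rewrite /pred_mean le_eqVlt; apply/orP; left; apply/eqP; congr (_ / _).
  by apply: eq_bigr => a _; apply: eq_bigr => b _; rewrite E.
rewrite /pred_mean le_eqVlt; apply/orP; left; apply/eqP; congr (_ / _).
rewrite exchange_big; apply: eq_bigr => a _; apply: eq_bigr => b _.
by rewrite (constr_sym _ _ e) E.
Qed.

Lemma max_P_preserves (S : {set 'S_q}) i j s a b :
  preserves S P -> s \in S -> edge I i j ->
  constr I i j a b -> constr I i j (s a) (s b).
Proof.
move=> SP sS e; have [l [E|E]] := IP e; first by rewrite !E; apply: SP.
by rewrite !(constr_sym _ _ e) !E; apply: SP.
Qed.

End MaxP.

Lemma sa_degree_ge (R : realType) (alpha : R) (d s n : nat) :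
  5 <= alpha * d%:R -> (5 <= d)%N -> (2 <= s)%N -> (s ^ d <= n)%N ->
  (s ^ 4 + s + 2 <= sa_degree alpha n)%N.
Proof.
move=> ad d5 s2 sn; apply: (@leq_trans (s ^ 5)%N).
  rewrite (expnSr s 4).
  have le4 : (2 ^ 3 * s <= s ^ 4)%N by rewrite (expnSr s 3) leq_mul2r leq_exp2r // s2 orbT.
  have : (s ^ 4 * 2 <= s ^ 4 * s)%N by rewrite leq_mul2l s2 orbT.
  apply: leq_trans; rewrite muln2 -addnn -addnA leq_add2l.
  apply: leq_trans le4; apply: (@leq_trans (2 * s)).
    by rewrite mul2n -addnn leq_add2l.
  by rewrite leq_mul2r orbT.
have s5 : (s ^ 5 <= n)%N by apply: leq_trans sn; rewrite leq_exp2l.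
rewrite /sa_degree leq_min s5 leq_max; apply/orP; right.
rewrite truncn_ge_nat ?powR_ge0 // natrX.
have s0 : 0 <= s%:R :> R by [].
have s1 : 1 <= s%:R :> R by rewrite ler1n ltnW.
have a0 : 0 <= alpha.
  have d0 : 0 < d%:R :> R by rewrite ltr0n (leq_trans _ d5).
  by rewrite -(pmulr_lge0 _ d0) (le_trans _ ad).
apply: (@le_trans _ _ ((s ^ d)%:R `^ alpha)); last first.
  by apply: ge0_ler_powR; rewrite ?nnegrE // ler_nat.
rewrite natrX -!powR_mulrn // -powRrM; apply: ler_powR => //.
by rewrite mulrC.
Qed.

Lemma sa_value_bound (R : realType) (n q t : nat) (I : csp R n q) (rho : R) :
  0 < rho ->
  (forall mu : forall S : {set 'I_n}, local_asg q S -> R,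
     is_pseudodist t mu -> rho * sa_objective t I mu <= csp_opt I) ->
  rho * sa_value t I <= csp_opt I.
Proof.
move=> rho0 h; have opt0 : 0 <= csp_opt I.
  exact: bigmax_ge_id.
rewrite /sa_value; set A := classical_sets.mkset _.
have [[x Ax]|A0] := pselect (exists x, A x); last first.
  rewrite sup_out ?mulr0 // => -[[x Ax] _].
  by apply: A0; exists x.
rewrite mulrC -ler_pdivlMr //; apply: ge_sup; first by exists x.
by move=> _ [mu pmu ->]; rewrite ler_pdivlMr // mulrC h.
Qed.

Theorem theorem4p6 (R : realType) (q : nat) (alpha : R) :
  (0 < q)%N -> 0 < alpha ->
  exists2 eps : R, 0 < eps &
    forall (k : nat) (P : 'I_k -> 'I_q -> 'I_q -> bool) (S : {set 'S_q}),
      (0 < k)%N ->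
      uniform_images R S ->
      preserves S P ->
      min_mean R P < 1 ->
      sa_approximates alpha (min_mean R P + eps) (@max_P R q k P).
Proof.
move=> q0 alpha0.
have qR : 1 <= q%:R :> R by rewrite ler1n.
have qR0 : 0 < q%:R :> R by rewrite ltr0n.
have q2 : 1 <= q%:R ^+ 2 :> R by rewrite exprn_ege1.
have q2gt : 0 < q%:R ^+ 2 :> R by lra.
pose d := maxn 5 (Num.truncn (5 / alpha)).+1.
have d5 : (5 <= d)%N by rewrite leq_maxl.
have d0 : (0 < d)%N by apply: leq_trans d5.
have ad : 5 <= alpha * d%:R.
  rewrite mulrC -ler_pdivrMr //; apply: le_trans (ltW (truncnS_gt _)) _.
  by rewrite ler_nat leq_maxr.
pose H := (8 * q ^ 8)%N.
have H8 : (8 <= H)%N by rewrite leq_pmulr // expn_gt0 q0.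
have H0 : (0 < H)%N by apply: leq_trans H8.
pose L := (4 * H ^ (2 * d))%N.
have L0 : (0 < L)%N by rewrite muln_gt0 expn_gt0 H0.
pose J := (2 * d).+1.
pose N0 := (2 * (L ^ 2) ^ J)%N.
have LN : (L <= N0)%N.
  rewrite /N0 -expnM; apply: (@leq_trans (L ^ (2 * J))); last by rewrite leq_pmull.
  by rewrite -{1}(expn1 L) leq_pexp2l.
have HL : (H <= L)%N.
  rewrite /L; apply: (@leq_trans (H ^ (2 * d))%N); last by rewrite leq_pmull.
  by rewrite -{1}(expn1 H) leq_pexp2l // muln_gt0.
pose n0 := (N0 ^ (2 * d))%N.
have N00 : (0 < N0)%N by apply: leq_trans LN.
have n00 : 0 < n0%:R :> R by rewrite ltr0n expn_gt0 N00.
pose lam : R := L%:R^-1.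
pose g1 : R := (lam ^- 2) ^- J / (4 * q%:R ^+ 2).
pose g2 : R := (q%:R ^+ 2)^-1 / n0%:R ^+ 2.
pose g := Num.min g1 g2.
have lam0 : 0 < lam by rewrite invr_gt0 ltr0n.
have lamM : 0 < lam ^- 2 by rewrite invr_gt0 exprn_gt0.
have g1_gt0 : 0 < g1.
  by apply: divr_gt0; [rewrite invr_gt0 exprn_gt0|rewrite mulr_gt0].
have g2_gt0 : 0 < g2 by rewrite divr_gt0 ?invr_gt0 // exprn_gt0.
have g_gt0 : 0 < g by rewrite lt_min g1_gt0.
have g_le1 : g <= 1.
  apply: (@le_trans _ _ g2); first by rewrite ge_min lexx orbT.
  rewrite /g2 -invfM invf_le1 ?mulr_gt0 ?exprn_gt0 //.
  by rewrite mulr_ege1 // exprn_ege1 // ler1n -(ltr0n R).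
exists (g / (2 * q%:R ^+ 2)); first by rewrite divr_gt0 // mulr_gt0.
move=> k P S k0 Su SP cl1 n I IP; set c := min_mean R P in cl1 *.
set eps := g / _.
have eps0 : 0 < eps by rewrite divr_gt0 // mulr_gt0.
have c0 : 0 <= c by apply: min_mean_ge0.
apply: sa_value_bound => [|mu mu_pd]; first exact: ltr_wpDl.
set t := sa_degree alpha n in mu mu_pd *.
pose W := half_weight I; pose C := constr I.
have W0 i j : 0 <= W i j := half_weight_ge0 I i j.
have Ws i j : W i j = W j i := half_weight_sym I i j.
have Wii i : W i i = 0 := half_weight_diag I i.
have W1 : \sum_i \sum_j W i j = 1 := half_weight_sum1 I.
have We i j : 0 < W i j -> edge I i j := @half_weight_edge _ _ _ I i j.
have opt_ge x : value W C x <= csp_opt I by rewrite -csp_valueE le_csp_opt.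
have n1 : (0 < n)%N.
  rewrite lt0n; apply/eqP => n0'; move: W1 => /eqP; rewrite big1 1?eq_sym ?oner_eq0 //.
  by move=> i; have := ltn_ord i; rewrite {2}n0'.
have nR1 : 0 < n%:R :> R by rewrite ltr0n.
have nR : 0 < n%:R ^+ 2 :> R by rewrite exprn_gt0.
have [i [j Wij]] : exists i j, (n%:R ^+ 2)^-1 <= W i j.
  have [||[i j] _ le] := @avg_attained R _ (fun _ : 'I_n * 'I_n => (n%:R ^+ 2)^-1)
    (fun e => W e.1 e.2).
  - by move=> _; rewrite invr_ge0 ltW.
  - rewrite sumr_const card_prod card_ord mulnn -[_ *+ _]mulr_natl natrX.
    by rewrite divff // gt_eqF.
  exists i, j; apply: le_trans le.
  by rewrite -mulr_sumr -(pair_bigA _ W) W1 mulr1.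
have W_gt0 : 0 < W i j by apply: lt_le_trans Wij; rewrite invr_gt0.
have eij := We _ _ W_gt0.
have nij : i != j by apply: contraTneq eij => ->; rewrite (edge_irr I).
have n2 : (1 < n)%N.
  rewrite ltnNge; apply/negP => n1'; case/negP: nij; apply/eqP/val_inj => /=.
  have lt1 (u : 'I_n) : nat_of_ord u = 0%N.
    by apply/eqP; rewrite -leqn0 -ltnS (leq_trans (ltn_ord u)).
  by rewrite !lt1.
have tn : (t <= n)%N by apply: geq_minl.
have t2 : (1 < t)%N by rewrite leq_min n2 leq_max leqnn.
pose a0 := Ordinal q0.
pose D := globalize t a0 mu.
have pdD : pseudodist t D by apply: globalize_pseudodist.
pose sat := sat_prob C D.
have sat01 u v := sat_prob01 C pdD u v t2.
have objE : sa_objective t I mu = \sum_u \sum_v W u v * sat u v.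
  rewrite half_weight_sum => [|u v e].
    apply: eq_bigr => u _; apply: eq_bigr => v _.
    by rewrite (pair_prob_globalize a0 mu_pd).
  rewrite /sat /sat_prob setUC; apply: ex_eq => x.
  by rewrite /C (constr_sym _ _ e).
rewrite objE; set obj := \sum_u _.
have obj01 : 0 <= obj <= 1.
  apply/andP; split.
    apply: sumr_ge0 => u _; apply: sumr_ge0 => v _.
    by rewrite mulr_ge0 //; case/andP: (sat01 u v).
  rewrite -W1; apply: ler_sum => u _; apply: ler_sum => v _.
  by rewrite ler_piMr //; case/andP: (sat01 u v).
have /andP[obj0 obj1] := obj01.
have epsq : eps * (2 * q%:R ^+ 2) = g by rewrite /eps divfK // gt_eqF ?mulr_gt0.
have [c_le0|c_gt0] := leP c 0.
  have cE : c = 0 by apply/eqP; rewrite eq_le c_le0.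
  have [x le] := uniform_value C Wii q0.
  rewrite cE add0r; apply: le_trans (opt_ge x); apply: le_trans le.
  apply: (@le_trans _ _ ((q%:R ^+ 2)^-1 * obj)).
    rewrite ler_wpM2r // -[leRHS]mul1r ler_pdivlMr //.
    have : 0 <= eps * q%:R ^+ 2 by rewrite mulr_ge0 // ltW.
    by lra.
  rewrite mulr_sumr; apply: ler_sum => u _.
  rewrite mulr_sumr; apply: ler_sum => v _.
  rewrite mulrCA ler_wpM2l //.
  have [m0|m0] := leP (pred_mean R (C u v)) 0.
    have Cf a b : C u v a b = false.
      apply/negP => /(pred_mean_sat R q0) m1.
      by have := le_lt_trans (le_trans m1 m0) (_ : 0 < (q%:R ^+ 2)^-1);
         rewrite ltxx invr_gt0 => /(_ q2gt).
    rewrite /sat /sat_prob /ex big1 ?mulr0 ?pred_mean_ge0 // => y _.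
    by rewrite Cf mulr0.
  have [a [b Cab]] := pred_mean_gt0 q0 m0.
  apply: le_trans (pred_mean_sat R q0 Cab).
  by apply: ler_piMr; [rewrite invr_ge0 ltW|case/andP: (sat01 u v)].
have SC u v s a b : s \in S -> 0 < W u v -> C u v a b -> C u v (s a) (s b).
  by move=> sS /We; apply: (max_P_preserves IP SP).
have cC u v : 0 < W u v -> c <= pred_mean R (C u v).
  by move/We => e; apply: (max_P_mean IP e).
have cl := min_mean_lt1 q0 cl1; rewrite -/c in cl.
have cg := min_mean_gt0 q0 c_gt0; rewrite -/c in cg.
have [a [b Cab]] := pred_mean_gt0 q0 (lt_le_trans c_gt0 (cC _ _ W_gt0)).
have Cba : C j i b a by rewrite /C -(constr_sym _ _ eij).
have [x0 le0] := single_edge_advantage W0 Wii W1 Su SC cC cl nij Cab Cba.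
have {}le0 := le_trans le0 (opt_ge x0).
have cge : c <= csp_opt I.
  apply: le_trans le0; rewrite lerDl mulr_ge0 // subr_ge0.
  by apply: le_trans cl _; rewrite gerBl invr_ge0 ltW.
suff adv : c + g - (1 - obj) <= csp_opt I.
  have [dl|dl] := leP (1 - obj) (g / 2).
    apply: le_trans adv; apply: (@le_trans _ _ (c + eps)).
      by rewrite ler_piMr // addr_ge0 // ltW.
    have : 0 <= eps * (q%:R ^+ 2 - 1) by rewrite mulr_ge0 ?subr_ge0 // ltW.
    lra.
  apply: le_trans cge.
  have e1 : (q%:R ^+ 2)^-1 * (g / 2) = eps.
    by rewrite /eps; field; rewrite gt_eqF // ltr0n.
  have : (q%:R ^+ 2)^-1 * (g / 2) <= c * (1 - obj).
    by rewrite ler_pM ?invr_ge0 ?divr_ge0 // ltW.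
  have : eps * obj <= eps by rewrite ler_piMr // ltW.
  rewrite e1; lra.
have [nn|nn] := ltnP n n0.
  have : c + g2 <= csp_opt I.
    apply: le_trans le0; rewrite lerD2l /g2; apply: ler_pM.
    - by rewrite invr_ge0 ltW.
    - by rewrite invr_ge0 exprn_ge0 // ltW.
    - lra.
    - apply: le_trans Wij; rewrite lef_pV2 ?posrE ?exprn_gt0 //.
      by rewrite lerXn2r ?nnegrE ?ler0n // ler_nat ltnW.
  have : g <= g2 by rewrite ge_min lexx orbT.
  lra.
have exk : exists k', (H ^ (2 ^ k' * d) <= n)%N.
  exists 0%N; rewrite expn0 mul1n; apply: leq_trans nn; rewrite /n0.
  apply: (@leq_trans (N0 ^ d)); first by rewrite leq_exp2r // (leq_trans HL).
  by rewrite leq_pexp2l // leq_pmull.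
have ubk k' : (H ^ (2 ^ k' * d) <= n)%N -> (k' <= n)%N.
  apply: leq_trans; apply: leq_trans (ltnW (ltn_expl _ (leq_trans _ H8))) => //.
  by apply: leq_trans (ltnW (ltn_expl k' (ltnSn 1))) _; rewrite leq_pmulr.
have [k' lek maxk] := ex_maxnP exk ubk.
pose s := (H ^ (2 ^ k'))%N.
have ns : (n < s ^ (2 * d))%N.
  rewrite ltnNge; apply/negP; rewrite /s -expnM mulnA -expnSr => /maxk.
  by rewrite ltnn.
have Ns : (N0 < s)%N.
  by rewrite -(@ltn_exp2r _ _ (2 * d)) ?muln_gt0 // (leq_ltn_trans nn).
have sd : (s ^ d <= n)%N by rewrite /s -expnM.
have s2 : (2 <= s)%N by apply: leq_trans Ns; rewrite ltnS.
have lamE : lam^-1 = 4 * H%:R ^+ (2 * d) by rewrite invrK /L natrM natrX.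
have lams : lam^-1 <= s%:R by rewrite invrK ler_nat (leq_trans LN) // ltnW.
have Ms : 2 * (lam ^- 2) ^+ J <= s%:R.
  rewrite -exprVn invrK -!natrX -natrM ler_nat; exact: ltnW.
have [x le] := advantage W0 Ws Wii W1 q0 Su SC cC cl pdD
  (sa_degree_ge ad d5 s2 sd) ns lamE lams d0 Ms.
have := le_trans le (opt_ge x); rewrite -/J -/g1 -/obj.
have : g <= g1 by rewrite ge_min lexx.
lra.
Qed.
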